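(* For any $r$ of the form $r = 1 - \tfrac{1}{t}$ with $t \ge 2$ and any $\epsilon > 0$, any algorithm that achieves a $(1 - r + \epsilon)$-approximation for FMSM on all instances satisfying $\min_{x \in P_{\mathcal{F}} \cup (\mathbb{1} - P_{\mathcal{F}})} \|x\|_\infty \le r$ requires an exponential number of value queries. The same holds for approximating the continuous relaxation $\max_{x \in P_{\mathcal{F}}} F(x)$. Furthermore, both statements hold even restricted to each of the two special cases: (i) $C = 2$ and $\mathcal{I} = 2^V$ (no matroid constraint); (ii) $C = 1$ and $\mathcal{I}$ is a partition matroid.
   Context: An FMSM instance consists of a ground set $V$ of $n$ elements, a non-negative (not necessarily monotone) submodular function $f : 2^V \to \mathbb{R}_{\ge 0}$ accessible only through a value oracle, a matroid $\mathcal{I} \subseteq 2^V$, a partition of $V$ into color groups $V_1,\dots,V_C$, and integer bounds $0 \le \ell_c \le u_c$. Fair sets $\mathcal{C} = \{S : \ell_c \le |S \cap V_c| \le u_c\ \forall c\}$, feasible sets $\mathcal{F} = \mathcal{I} \cap \mathcal{C}$ (nonempty); the goal is $\max_{S \in \mathcal{F}} f(S)$. An $\alpha$-approximation outputs a feasible set of value at least $\alpha$ times the optimum. $P_{\mathcal{F}} = \mathrm{conv}\{\mathbb{1}_S : S \in \mathcal{F}\}$, $\mathbb{1} - P_{\mathcal{F}} = \{x \in [0,1]^n : \mathbb{1} - x \in P_{\mathcal{F}}\}$, and $F(x) = \sum_{S \subseteq V} f(S)\prod_{i\in S}x_i\prod_{j\notin S}(1-x_j)$ is the multilinear extension. A partition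 matroid: $V$ partitioned into blocks $G_i$ with bounds $k_i$, $X$ independent iff $|X \cap G_i| \le k_i$ for all $i$. *)

(* Defs.v *)
From HB Require Import structures.
From mathcomp Require Import all_boot all_order all_algebra.
From mathcomp Require Import reals.
Set Implicit Arguments. Unset Strict Implicit. Unset Printing Implicit Defensive.
Import Order.TTheory GRing.Theory Num.Theory.
Local Open Scope ring_scope.

Section FMSM.
Variable R : realType.
Variable n : nat.
Notation V := 'I_n.

Definition nonneg_setfun (f : {set V} -> R) := forall S, 0 <= f S.
Definition submodular (f : {set V} -> R) :=
  forall A B : {set V}, f (A :|: B) + f (A :&: B) <= f A + f B.

Definition is_matroid (I : {set {set V}}) :=
  [/\ set0 \in I,
      (forall A B : {set V}, B \in I -> A \subset B -> A \in I) &
      (forall A B : {set V}, A \in I -> B \in I -> #|A| < #|B| ->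
         exists2 x, x \in B :\: A & x |: A \in I)]%N.

Definition is_partition_matroid (I : {set {set V}}) :=
  exists (K : nat) (g : V -> 'I_K) (k : 'I_K -> nat),
    I = [set X : {set V} | [forall i : 'I_K, #|X :&: [set v | g v == i]| <= k i]]%N.

Record constraint := Constraint {
  ncol : nat;
  col : V -> 'I_ncol;
  lb : 'I_ncol -> nat;
  ub : 'I_ncol -> nat;
  indep : {set {set V}}
}.
Arguments col : clear implicits.
Arguments lb : clear implicits.
Arguments ub : clear implicits.

Definition fair (K : constraint) (S : {set V}) :=
  [forall c : 'I_(ncol K),
     (lb K c <= #|S :&: [set v | col K v == c]| <= ub K c)%N].

Definition feasible (K : constraint) : {set {set V}} :=
  [set S in indep K | fair K S].

Definition well_formed (K : constraint) :=
  [/\ is_matroid (indep K),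
      (forall c, lb K c <= ub K c)%N &
      exists S0 : {set V}, S0 \in feasible K].

Definition in_polytope (F : {set {set V}}) (x : V -> R) :=
  exists lam : {set V} -> R,
    [/\ forall S, 0 <= lam S,
        forall S, S \notin F -> lam S = 0,
        \sum_(S : {set V}) lam S = 1 &
        forall i, x i = \sum_(S : {set V}) lam S * (i \in S)%:R].

Definition in_co_polytope (F : {set {set V}}) (x : V -> R) :=
  (forall i, 0 <= x i <= 1) /\ in_polytope F (fun i => 1 - x i).

(* min_{x ∈ P_F ∪ (1 - P_F)} ||x||_oo <= r  (the minimum is attained,
   the sets being compact; all points have nonnegative coordinates) *)
Definition min_linf_le (F : {set {set V}}) (r : R) :=
  exists x : V -> R,
    (in_polytope F x \/ in_co_polytope F x) /\ forall i, `|x i| <= r.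

Definition multilinear (f : {set V} -> R) (x : V -> R) : R :=
  \sum_(S : {set V}) f S * \prod_(i in S) x i * \prod_(i in ~: S) (1 - x i).

Inductive inst_class := GeneralClass | TwoColorsNoMatroid | OneColorPartition.

Definition in_class (cl : inst_class) (K : constraint) :=
  match cl with
  | GeneralClass => True
  | TwoColorsNoMatroid => ncol K = 2%N /\ indep K = setT
  | OneColorPartition => ncol K = 1%N /\ is_partition_matroid (indep K)
  end.

Definition admissible (cl : inst_class) (r : R) (K : constraint)
  (f : {set V} -> R) :=
  [/\ in_class cl K, well_formed K, nonneg_setfun f, submodular f &
      min_linf_le (feasible K) r].

(* A deterministic adaptive strategy: given the answers received so far,
   either ask the value of f on a set, or stop with an output. *)
Inductive step (Out : Type) := Query of {set V} | Done of Out.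
Definition strategy (Out : Type) := seq R -> step Out.

Fixpoint run (Out : Type) (A : strategy Out) (f : {set V} -> R) (q : nat)
  (h : seq R) : option Out :=
  match A h with
  | Done o => Some o
  | Query X => if q is q'.+1 then run A f q' (rcons h (f X)) else None
  end.

(* A (possibly randomized) algorithm: for each constraint (which is known
   to the algorithm) a finite probability distribution over strategies. *)
Definition algorithm (Out : Type) := constraint -> seq (R * strategy Out).

Definition is_distribution (Out : Type) (d : seq (R * strategy Out)) :=
  (forall p, p \in map fst d -> 0 <= p) /\ \sum_(p <- map fst d) p = 1.

Fixpoint all_prop (T : Type) (P : T -> Prop) (s : seq T) : Prop :=
  if s is x :: s' then P x /\ all_prop P s' else True.

Definition out_value (Out : Type) (value : Out -> R) (A : strategy Out)
  (f : {set V} -> R) (q : nat) : R :=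
  if run A f q [::] is Some o then value o else 0.

Definition achieves (Out : Type) (valid : Out -> Prop) (value : Out -> R)
  (d : seq (R * strategy Out)) (f : {set V} -> R) (q : nat) (alpha : R) :=
  [/\ is_distribution d,
      all_prop (fun ps => exists2 o, run ps.2 f q [::] = Some o & valid o) d &
      forall y, valid y ->
        alpha * value y <= \sum_(ps <- d) ps.1 * out_value value ps.2 f q].

Definition solves_discrete (cl : inst_class) (r : R) (A : algorithm {set V})
  (q : nat) (alpha : R) :=
  forall (K : constraint) (f : {set V} -> R), admissible cl r K f ->
    achieves (fun S => S \in feasible K) f (A K) f q alpha.

Definition solves_relaxation (cl : inst_class) (r : R) (A : algorithm (V -> R))
  (q : nat) (alpha : R) :=
  forall (K : constraint) (f : {set V} -> R), admissible cl r K f ->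
    achieves (in_polytope (feasible K)) (multilinear f) (A K) f q alpha.
End FMSM.

(* Main.v *)
Require Import Defs.
From HB Require Import structures.
From mathcomp Require Import all_boot all_order all_algebra.
From mathcomp Require Import reals sequences exp.
From mathcomp Require Import ring lra zify.
Set Implicit Arguments. Unset Strict Implicit. Unset Printing Implicit Defensive.
Import Order.TTheory GRing.Theory Num.Theory.
Local Open Scope ring_scope.

(** Proof idea. With p = t - 1, split the ground set into a left and a right
    half, each cut into m blocks of t elements; a set is feasible when it has m
    elements on the left and p m on the right.  A random s hides one element of
    every block, which gets weight p while the others get -1.  Let X, Z count
    the left and right elements of S, and let U, V be its left and right hidden
    weights.  The function p X (t m - Z) - U V is the directed cut function with
    all arcs from hidden left to hidden right and from other left to other right
    elements; its maximum over feasible sets is p t m^2, reached at "hidden left,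
    non-hidden right", whereas p X (t m - Z) has the value p m^2 on every
    feasible set, a factor t less.
    To make the two indistinguishable, U V is cancelled exactly near U = V = 0 by
    adding the average over l of clamp_l(U) clamp_l(V), where l has density
    proportional to 1/l between D and 2^J D.  The mixed second differences stay
    nonpositive since clamping is monotone and 1-Lipschitz; the pure ones are
    O(p^2/J) because clamp_l is curved only at |U| = l and om_l l <= 2/J, and
    this is absorbed by a small concave term beta (X (t m - X) + Z (t m - Z)); the
    constant (2^J D)^2 restores nonnegativity.
    A fixed query has |U|, |V| <= D except with probability exponentially small
    in m, so few queries see only the symmetric function. *)

(** * Submodularity from two-element exchanges *)

(** Two inductions: peeling elements off [T :\: S] turns the exchange of two elements into
    diminishing returns on nested sets, and peeling elements off [A :\: B] turns that into the
    lattice inequality. *)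
Lemma submodular_local (R : realType) (n : nat) (f : {set 'I_n} -> R) :
  (forall (S : {set 'I_n}) x y, x \notin S -> y \notin S -> x != y ->
     f (x |: (y |: S)) + f S <= f (x |: S) + f (y |: S)) ->
  submodular f.
Proof.
move=> loc.
have marg (T : {set 'I_n}) x (S : {set 'I_n}) : S \subset T -> x \notin T ->
    f (x |: T) + f S <= f (x |: S) + f T.
  move=> sST xT; move: {2}#|T :\: S| (leqnn #|T :\: S|) => j.
  elim: j T sST xT => [|j IH] T sST xT.
    rewrite leqn0 cards_eq0 setD_eq0 => sTS.
    by have -> : T = S by apply/eqP; rewrite eqEsubset sTS.
  have [E|[y]] := set_0Vmem (T :\: S).
    have -> : T = S by apply/eqP; rewrite eqEsubset sST andbT -setD_eq0 E.
    by [].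
  rewrite inE => /andP[yS yT] cT.
  have yx : x != y by apply: contraNneq xT => ->.
  have := loc (T :\ y) x y; rewrite setD1K // !inE eqxx (negbTE xT) andbF.
  move=> /(_ isT isT yx) H1.
  have := IH (T :\ y); rewrite !inE (negbTE xT) andbF.
  have -> : S \subset T :\ y.
    by rewrite subsetD1 sST yS.
  have -> : (#|(T :\ y) :\: S| <= j)%N.
    have -> : (T :\ y) :\: S = (T :\: S) :\ y.
      by apply/setP => z; rewrite !inE andbCA.
    by move: cT; rewrite (cardsD1 y (T :\: S)) !inE yS yT.
  by move=> /(_ isT isT isT) H2; lra.
move=> A B; move: {2}#|A :\: B| (leqnn #|A :\: B|) => j.
elim: j A => [|j IH] A.
  rewrite leqn0 cards_eq0 setD_eq0 => sAB.
  by rewrite (setUidPr sAB) (setIidPl sAB) addrC.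
have [E|[y]] := set_0Vmem (A :\: B).
  move: E => /eqP; rewrite setD_eq0 => sAB _.
  by rewrite (setUidPr sAB) (setIidPl sAB) addrC.
rewrite inE => /andP[yB yA] cA.
have := IH (A :\ y).
have -> : (#|(A :\ y) :\: B| <= j)%N.
  have -> : (A :\ y) :\: B = (A :\: B) :\ y.
    by apply/setP => z; rewrite !inE andbCA.
  by move: cA; rewrite (cardsD1 y (A :\: B)) !inE yB yA.
move=> /(_ isT).
have -> : (A :\ y) :&: B = A :&: B.
  apply/setP => z; rewrite !inE; have [->|] := eqVneq z y; rewrite //=.
  by rewrite (negbTE yB) andbF.
move=> H1.
(* [y] gains no more over [(A :\ y) :|: B] than over [A :\ y]; added to [H1], this puts [y] back. *)
have := marg ((A :\ y) :|: B) y (A :\ y) (subsetUl _ _).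
rewrite !inE eqxx (negbTE yB) /= => /(_ isT).
by rewrite setUA !setD1K // => H2; lra.
Qed.

(** * Truncation to a symmetric interval *)

Section Clamp.
Variable R : realType.
Implicit Types l u v s t p : R.

Definition clamp l u : R := Num.max (- l) (Num.min l u).

Lemma clamp_id l u : `|u| <= l -> clamp l u = u.
Proof.
rewrite ler_norml => /andP[h1 h2]; rewrite /clamp.
by rewrite (min_idPr h2) (max_idPr h1).
Qed.

Lemma clamp_ge l u : 0 <= l -> l <= u -> clamp l u = l.
Proof. by move=> h1 h2; rewrite /clamp (min_idPl h2); apply/max_idPr; lra. Qed.

Lemma clamp_le l u : 0 <= l -> u <= - l -> clamp l u = - l.
Proof.
move=> h1 h2; rewrite /clamp; apply/max_idPl.
by rewrite ge_min h2 orbT.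
Qed.

Variant clamp_spec l u : R -> Prop :=
| ClampLow of u <= - l : clamp_spec l u (- l)
| ClampMid of - l <= u & u <= l : clamp_spec l u u
| ClampHigh of l <= u : clamp_spec l u l.

Lemma clampP l u : 0 <= l -> clamp_spec l u (clamp l u).
Proof.
move=> l0; have [h|/ltW h] := leP u (- l).
  by rewrite clamp_le //; constructor.
have [h'|/ltW h'] := leP u l.
  by rewrite clamp_id ?ler_norml ?h //; constructor.
by rewrite clamp_ge //; constructor.
Qed.

Lemma norm_clamp_le l u : 0 <= l -> `|clamp l u| <= l.
Proof. by move=> l0; rewrite ler_norml; case: clampP => //; lra. Qed.

Lemma clamp_step l u v : 0 <= l -> u <= v ->
  0 <= clamp l v - clamp l u <= v - u.
Proof. by move=> l0 uv; case: (clampP u l0) => //; case: (clampP v l0) => //; lra. Qed.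

(* The two increments are [mu * s] and [nu * t] for some [mu], [nu] in [0, 1]. *)
Lemma clamp_step_mul l u v s t p : 0 <= l -> 0 <= p -> - p <= s * t ->
  (clamp l (u + s) - clamp l u) * (clamp l (v + t) - clamp l v) <= p + s * t.
Proof.
move=> l0 p0.
have [hs|/ltW hs] := leP 0 s; have [ht|/ltW ht] := leP 0 t.
- have := @clamp_step l u (u + s) l0 ltac:(lra).
  have := @clamp_step l v (v + t) l0 ltac:(lra).
  by nra.
- have := @clamp_step l u (u + s) l0 ltac:(lra).
  have := @clamp_step l (v + t) v l0 ltac:(lra).
  by nra.
- have := @clamp_step l (u + s) u l0 ltac:(lra).
  have := @clamp_step l v (v + t) l0 ltac:(lra).
  by nra.
- have := @clamp_step l (u + s) u l0 ltac:(lra).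
  have := @clamp_step l (v + t) v l0 ltac:(lra).
  by nra.
Qed.

(** The increments over the same step [s], taken at [u + t] and at [u], both lie between 0 and [s],
    so they differ by at most [|s|]. *)
Lemma clamp_second l u s t p : 0 <= l -> `|s| <= p -> `|t| <= p ->
  `|clamp l (u + s + t) - clamp l (u + s) - clamp l (u + t) + clamp l u| <= p.
Proof.
move=> l0; rewrite !ler_norml => /andP[s1 s2] /andP[t1 t2].
have [hs|/ltW hs] := leP 0 s.
- have := @clamp_step l u (u + s) l0 ltac:(lra).
  have := @clamp_step l (u + t) (u + s + t) l0 ltac:(lra).
  by lra.
- have := @clamp_step l (u + s) u l0 ltac:(lra).
  have := @clamp_step l (u + s + t) (u + t) l0 ltac:(lra).
  by lra.
Qed.

(** The clamp bends only at [l] and [- l]; a point farther than [2 * p] from both stays on one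
    affine piece along both steps. *)
Lemma clamp_second0 l u s t p : 0 <= l -> `|s| <= p -> `|t| <= p ->
  2 * p < `| `|u| - l | ->
  clamp l (u + s + t) - clamp l (u + s) - clamp l (u + t) + clamp l u = 0.
Proof.
move=> l0; rewrite !ler_norml => /andP[s1 s2] /andP[t1 t2].
rewrite lter_normr => /orP[h|h].
- move: h; rewrite ltrBrDl lter_normr => /orP[h|h].
    by rewrite !clamp_ge //; lra.
  by rewrite !clamp_le //; lra.
- have : `|u| < l - 2 * p by lra.
  by rewrite ltr_norml => /andP[h1 h2]; rewrite !clamp_id ?ler_norml //; lra.
Qed.

End Clamp.

(** * Weighted averages of products of truncations *)

(** Each doubling of the range adds [e] terms, none below [1 / (2 * e)], hence at least [1 / 2]. *)
Lemma harmonic_block_ge (R : realType) (d j : nat) : (0 < d)%N ->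
  j%:R / 2 <= \sum_(d <= l < 2 ^ j * d) (l%:R : R)^-1.
Proof.
move=> d0; elim: j => [|j IH].
  by rewrite mul0r expn0 mul1n big_geq.
have e0 : (0 < 2 ^ j * d)%N by rewrite muln_gt0 expn_gt0.
rewrite expnS -mulnA mul2n -addnn.
rewrite (big_cat_nat (n := 2 ^ j * d)) ?leq_addr //=; last first.
  by rewrite leq_pmull // expn_gt0.
rewrite -natr1 mulrDl; apply: lerD => //.
set e := (2 ^ j * d)%N in e0 *.
have e0' : 0 < e%:R :> R by rewrite ltr0n.
apply: (@le_trans _ _ (\sum_(e <= l < e + e) ((2 * e%:R : R)^-1))).
  rewrite sumr_const_nat addnK -[_ *+ e]mulr_natr.
  by rewrite le_eqVlt; apply/orP; left; apply/eqP; field; lra.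
apply: ler_sum_nat => l /andP[le1 le2].
rewrite lef_pV2 ?posrE ?mulr_gt0 ?ltr0n //; last by lia.
by rewrite -natrM ler_nat; lia.
Qed.

(** Limits how many clamp levels can bend near [|u|]: with [t] the integer part of [|u|], they all
    lie among [t - c, ..., t + c]. *)
Lemma near_count_le (R : realType) (a b c : nat) (u : R) :
  \sum_(a <= l < b) (`| `|u| - l%:R | <= c%:R)%R%:R <= (2 * c).+1%:R :> R.
Proof.
rewrite -natr_sum ler_nat -big_mkcond /= sum1_count -size_filter.
set s := filter _ _.
have [t0 t1] : (Num.truncn `|u|)%:R <= `|u| /\ `|u| < (Num.truncn `|u|).+1%:R.
  by apply/andP/truncn_itv.
move: (Num.truncn _) t0 t1 => t t0 t1.
suff sub : {subset s <= iota (t - c) (2 * c).+1}.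
  by rewrite -(size_iota (t - c) (2 * c).+1); apply: uniq_leq_size => //;
     rewrite filter_uniq // iota_uniq.
move=> l; rewrite mem_filter => /andP[+ _]; rewrite ler_norml => /andP[h1 h2].
have : (l%:R : R) < (t + c).+1%:R by rewrite -addSn natrD; lra.
have : (t%:R : R) <= (l + c)%:R by rewrite natrD; lra.
rewrite ler_nat ltr_nat mem_iota; lia.
Qed.

Section ClampMixture.
Variables (R : realType) (a b : nat) (om : nat -> R) (kappa : R).
Hypothesis om_ge0 : forall l, 0 <= om l.
Hypothesis om_sum : \sum_(a <= l < b) om l = 1.
Hypothesis om_le : forall l, om l * l%:R <= kappa.
Implicit Types u v s t : R.

Definition clamp_mix u v : R :=
  \sum_(a <= l < b) om l * (clamp l%:R u * clamp l%:R v).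

Let om_avg c : \sum_(a <= l < b) om l * c = c.
Proof. by rewrite -mulr_suml om_sum mul1r. Qed.

Lemma clamp_mixC u v : clamp_mix u v = clamp_mix v u.
Proof. by apply: eq_bigr => l _; rewrite [clamp _ u * _]mulrC. Qed.

Lemma clamp_mix_id u v : `|u| <= a%:R -> `|v| <= a%:R -> clamp_mix u v = u * v.
Proof.
move=> hu hv; rewrite -[RHS]om_avg.
apply: eq_big_nat => l /andP[al _].
by rewrite !clamp_id //; apply: le_trans (_ : a%:R <= _); rewrite // ler_nat.
Qed.

Lemma norm_clamp_mix u v : `|clamp_mix u v| <= b%:R ^+ 2.
Proof.
apply: le_trans (ler_norm_sum _ _ _) _.
rewrite -[leRHS]om_avg; apply: ler_sum_nat => l /andP[_ lb].
rewrite normrM ger0_norm // ler_wpM2l // normrM expr2.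
have cb x : `|clamp l%:R x| <= b%:R :> R.
  by apply: le_trans (norm_clamp_le _ (ler0n _ _)) _; rewrite ler_nat ltnW.
exact: ler_pM.
Qed.

Lemma clamp_mix_cross u v s t p : 0 <= p -> - p <= s * t ->
  clamp_mix (u + s) (v + t) - clamp_mix (u + s) v
    - clamp_mix u (v + t) + clamp_mix u v <= p + s * t.
Proof.
move=> p0 st; rewrite /clamp_mix -!sumrB -big_split /=.
rewrite -[leRHS]om_avg; apply: ler_sum => l _.
rewrite -!mulrBr -mulrDr ler_wpM2l //.
by have := @clamp_step_mul R l%:R u v s t p (ler0n _ _) p0 st; lra.
Qed.

(** Only levels within [2 * p] of [|u|] see any curvature. Each costs at most [om l * p * l], since
    the other factor is clamped to size [l], and there are at most [4 p + 1] of them. *)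
Lemma clamp_mix_second u v s t (p : nat) : `|s| <= p%:R -> `|t| <= p%:R ->
  clamp_mix (u + s + t) v - clamp_mix (u + s) v
    - clamp_mix (u + t) v + clamp_mix u v <= p%:R * kappa * (2 * (2 * p)).+1%:R.
Proof.
move=> hs ht; rewrite /clamp_mix -!sumrB -big_split /=.
apply: le_trans (_ : p%:R * kappa *
  \sum_(a <= l < b) (`| `|u| - l%:R | <= (2 * p)%:R)%R%:R <= _); last first.
  rewrite ler_wpM2l ?near_count_le // mulr_ge0 //.
  (* The case [l = 0] of [om_le] says that [kappa] is nonnegative. *)
  by apply: le_trans (om_le 0); rewrite mulr0.
rewrite mulr_sumr; apply: ler_sum => l _.
rewrite -!mulrBr -mulrDr -!mulrBl -mulrDl.
case: (leP (`| `|u| - l%:R |) (2 * p)%:R) => h; last first.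
  have -> := clamp_second0 (ler0n _ l) hs ht; first by rewrite mul0r !mulr0.
  by rewrite -natrM.
rewrite mulr1; apply: le_trans (ler_norm _) _; rewrite !normrM ger0_norm //.
apply: le_trans (_ : om l * (p%:R * l%:R) <= _).
  by rewrite ler_wpM2l // ler_pM // ?norm_clamp_le // clamp_second.
by rewrite mulrCA ler_wpM2l.
Qed.

End ClampMixture.

(** * The smoothed cut function *)

Section Gadget.
Variables (R : realType) (n : nat) (side : 'I_n -> bool).
Variables (a b p : nat) (om : nat -> R) (N beta : R).
Implicit Types (w : 'I_n -> R) (S : {set 'I_n}).

Definition lweight w S : R := \sum_(v in S | side v) w v.
Definition rweight w S : R := \sum_(v in S | ~~ side v) w v.

(** [N] stands for the size of either side, and the clamp levels run from [a] to [b - 1]. At [w = 0]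
    the value depends on the counts [X] and [Z] alone: this is the common decoy for all hidden
    weights. *)
Definition gadget w S : R :=
  let X := lweight (fun=> 1) S in let Z := rweight (fun=> 1) S in
  let U := lweight w S in let V := rweight w S in
  p%:R * X * (N - Z) - U * V + clamp_mix a b om U V
    + beta * (X * (N - X) + Z * (N - Z)) + b%:R ^+ 2.

Hypothesis p_gt0 : (0 < p)%N.
Hypothesis om_ge0 : forall l, 0 <= om l.
Hypothesis om_sum : \sum_(a <= l < b) om l = 1.
Hypothesis om_le : forall l, om l * l%:R * (p * (2 * (2 * p)).+1)%:R <= beta.
Hypothesis lcard : lweight (fun=> 1) setT = N.
Hypothesis rcard : rweight (fun=> 1) setT = N.

Lemma lweightU1 w S x : x \notin S ->
  lweight w (x |: S) = lweight w S + (if side x then w x else 0).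
Proof. by move=> xS; rewrite /lweight !big_mkcondr big_setU1 //= addrC. Qed.

Lemma rweightU1 w S x : x \notin S ->
  rweight w (x |: S) = rweight w S + (if side x then 0 else w x).
Proof.
by move=> xS; rewrite /rweight !big_mkcondr big_setU1 //= addrC if_neg.
Qed.

Lemma lweight_le w S : (forall v, 0 <= w v) -> 0 <= lweight w S <= lweight w setT.
Proof.
move=> w0; rewrite sumr_ge0 //= /lweight 2!big_mkcondl /=.
by apply: ler_sum => v _; rewrite inE; case: ifP.
Qed.

Lemma rweight_le w S : (forall v, 0 <= w v) -> 0 <= rweight w S <= rweight w setT.
Proof.
move=> w0; rewrite sumr_ge0 //= /rweight 2!big_mkcondl /=.
by apply: ler_sum => v _; rewrite inE; case: ifP.
Qed.

(** [kappa] is chosen to make the bound of [clamp_mix_second] exactly [beta]. *)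
Let kappa_ge : exists2 kappa, (forall l, om l * l%:R <= kappa) &
  p%:R * kappa * (2 * (2 * p)).+1%:R = beta.
Proof.
have P0 : 0 < (p * (2 * (2 * p)).+1)%:R :> R by rewrite ltr0n muln_gt0 p_gt0.
exists (beta / (p * (2 * (2 * p)).+1)%:R).
  by move=> l; rewrite ler_pdivlMr.
by rewrite mulrAC -natrM mulrC divfK // gt_eqF.
Qed.

(** On one side, the quadratic terms have second difference [- 2 * beta] against at most [beta] from
    the mixture. Across the sides, [p X (N - Z)] gives [- p], [- U * V] gives [- w x * w y], and the
    mixture gives at most [p + w x * w y]. *)
Lemma gadget_submodular w : (forall v, -1 <= w v <= p%:R) -> 0 <= beta ->
  submodular (gadget w).
Proof.
move=> hw b0; have [kappa om_kappa kappaE] := kappa_ge.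
have p1 : 1 <= p%:R :> R by rewrite ler1n.
have hn v : `|w v| <= p%:R.
  by rewrite ler_norml; have := hw v; lra.
have hprod x y : - p%:R <= w x * w y.
  have /andP[x1 x2] := hw x; have /andP[y1 y2] := hw y.
  have [x0|/ltW x0] := leP 0 (w x).
    have : 0 <= w x * (w y + 1) by rewrite mulr_ge0 //; lra.
    by lra.
  have : 0 <= - w x * (p%:R - w y) by rewrite mulr_ge0 //; lra.
  have : 0 <= (w x + 1) * p%:R by rewrite mulr_ge0 //; lra.
  by lra.
apply: submodular_local => S x y xS yS xy.
have xyS : x \notin y |: S by rewrite !inE negb_or xy.
rewrite /gadget !lweightU1 // !rweightU1 //.
set X := lweight (fun=> 1) S; set Z := rweight (fun=> 1) S.
set U := lweight w S; set V := rweight w S.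
have mixC := clamp_mixC a b om.
case: (side x); case: (side y); rewrite ?addr0.
- have := clamp_mix_second a b om_ge0 om_kappa U V (hn y) (hn x).
  by rewrite kappaE; lra.
- have := @clamp_mix_cross R a b om om_ge0 om_sum U V (w x) (w y) p%:R (ler0n _ _)
    (hprod x y).
  by lra.
- have := @clamp_mix_cross R a b om om_ge0 om_sum U V (w y) (w x) p%:R (ler0n _ _)
    (hprod y x).
  by lra.
- have := clamp_mix_second a b om_ge0 om_kappa V U (hn y) (hn x).
  by rewrite kappaE -!(mixC U); lra.
Qed.

Let lr_bounds S : (0 <= lweight (fun=> 1) S <= N) * (0 <= rweight (fun=> 1) S <= N).
Proof. by rewrite -{1}lcard -rcard lweight_le ?rweight_le. Qed.

(* The identity
   [(p+1) (p X (N-Z) - U V) = p (X+U) (N-Z-V) + (p X - U) (p (N-Z) + V)]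
   is the decomposition of the cut into its two kinds of arcs. *)
Lemma gadget_ge w S : (forall v, -1 <= w v <= p%:R) -> rweight w setT = 0 ->
  0 <= beta ->
  p%:R * lweight (fun=> 1) S * (N - rweight (fun=> 1) S)
    - lweight w S * rweight w S <= gadget w S /\ 0 <= gadget w S.
Proof.
move=> hw w0 b0; rewrite /gadget.
have p0 : 0 <= p%:R :> R by [].
have [] := lr_bounds S.
have := norm_clamp_mix om_ge0 om_sum (lweight w S) (rweight w S).
rewrite ler_norml.
have : 0 <= lweight (fun v => 1 + w v) S.
  by apply: sumr_ge0 => v _; have := hw v; lra.
have : 0 <= lweight (fun v => p%:R - w v) S.
  by apply: sumr_ge0 => v _; have := hw v; lra.
(* Monotonicity in [S] bounds the right weights of the complement below by zero; as [w] sums to zero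
   on the right, these weights are [N - Z - V] here and [p (N - Z) + V] next. *)
have /andP[_] : 0 <= rweight (fun v => 1 + w v) S <= rweight (fun v => 1 + w v) setT.
  by apply: rweight_le => v; have := hw v; lra.
have /andP[_] : 0 <= rweight (fun v => p%:R - w v) S <= rweight (fun v => p%:R - w v) setT.
  by apply: rweight_le => v; have := hw v; lra.
have sl c w1 w2 T : lweight (fun v => c * w1 v + w2 v) T = c * lweight w1 T + lweight w2 T.
  by rewrite /lweight mulr_sumr -big_split.
have sr c w1 w2 T : rweight (fun v => c * w1 v + w2 v) T = c * rweight w1 T + rweight w2 T.
  by rewrite /rweight mulr_sumr -big_split.
have El T : lweight (fun v => 1 + w v) T = lweight (fun=> 1) T + lweight w T.
  by rewrite -[lweight (fun=> 1) T]mul1r -sl; apply: eq_bigr => v _; ring.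
have Er T : rweight (fun v => 1 + w v) T = rweight (fun=> 1) T + rweight w T.
  by rewrite -[rweight (fun=> 1) T]mul1r -sr; apply: eq_bigr => v _; ring.
have Fl T : lweight (fun v => p%:R - w v) T = p%:R * lweight (fun=> 1) T - lweight w T.
  rewrite -[lweight w T]mul1r -mulNr [LHS](_ : _ = lweight (fun v => (-1) * w v + p%:R * 1) T).
    rewrite sl addrC; congr (_ + _); rewrite /lweight mulr_sumr; exact: eq_bigr.
  by apply: eq_bigr => v _; ring.
have Fr T : rweight (fun v => p%:R - w v) T = p%:R * rweight (fun=> 1) T - rweight w T.
  rewrite -[rweight w T]mul1r -mulNr [LHS](_ : _ = rweight (fun v => (-1) * w v + p%:R * 1) T).
    rewrite sr addrC; congr (_ + _); rewrite /rweight mulr_sumr; exact: eq_bigr.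
  by apply: eq_bigr => v _; ring.
rewrite El Fl !Er !Fr rcard w0.
set X := lweight (fun=> 1) S; set Z := rweight (fun=> 1) S.
set U := lweight w S; set V := rweight w S; set M := clamp_mix _ _ _ _ _.
move=> h1 h2 h3 h4 /andP[h5 h6] /andP[X0 XN] /andP[Z0 ZN].
have B0 : 0 <= beta * (X * (N - X) + Z * (N - Z)).
  by rewrite mulr_ge0 // addr_ge0 // mulr_ge0 //; lra.
have C1 : 0 <= p%:R * ((X + U) * (N - Z - V)).
  by rewrite mulr_ge0 // mulr_ge0 //; lra.
have C2 : 0 <= (p%:R * X - U) * (p%:R * (N - Z) + V).
  by rewrite mulr_ge0 //; lra.
have C : 0 <= p%:R * X * (N - Z) - U * V.
  rewrite -(@pmulr_rge0 _ (p%:R + 1)); last by lra.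
  by lra.
(* The mixture is at least [- b ^ 2], which the added constant makes up for. *)
by split; lra.
Qed.

(** Caps the damage done by exceptional hidden weights; [|U| <= p X <= p N], and likewise for [V],
    bounds the product term. *)
Lemma gadget_le w S : (forall v, -1 <= w v <= p%:R) -> 0 <= beta ->
  gadget w S <= (p%:R + p%:R ^+ 2 + 2 * beta) * N ^+ 2 + 2 * b%:R ^+ 2.
Proof.
move=> hw b0; rewrite /gadget.
have p1 : 1 <= p%:R :> R by rewrite ler1n.
have [] := lr_bounds S.
have := norm_clamp_mix om_ge0 om_sum (lweight w S) (rweight w S).
rewrite ler_norml.
have hn v : `|w v| <= p%:R * 1 by rewrite ler_norml; have := hw v; lra.
have : `|lweight w S| <= p%:R * lweight (fun=> 1) S.
  by apply: le_trans (ler_norm_sum _ _ _) _; rewrite mulr_sumr ler_sum.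
have : `|rweight w S| <= p%:R * rweight (fun=> 1) S.
  by apply: le_trans (ler_norm_sum _ _ _) _; rewrite mulr_sumr ler_sum.
set X := lweight (fun=> 1) S; set Z := rweight (fun=> 1) S.
set U := lweight w S; set V := rweight w S; set M := clamp_mix _ _ _ _ _.
move=> h1 h2 /andP[h5 h6] /andP[X0 XN] /andP[Z0 ZN].
have N0 : 0 <= N by lra.
have UV : - (U * V) <= p%:R ^+ 2 * N ^+ 2.
  apply: le_trans (ler_norm _) _; rewrite normrN normrM -exprMn expr2.
  apply: ler_pM => //; [apply: (le_trans h2) | apply: (le_trans h1)];
    by rewrite ler_wpM2l.
have XZ : p%:R * X * (N - Z) <= p%:R * N ^+ 2.
  by rewrite -mulrA ler_wpM2l // expr2 ler_pM //; lra.
have BB : beta * (X * (N - X) + Z * (N - Z)) <= beta * (2 * N ^+ 2).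
  by rewrite ler_wpM2l //; nra.
by lra.
Qed.

Lemma gadget0 S :
  gadget (fun=> 0) S = p%:R * lweight (fun=> 1) S * (N - rweight (fun=> 1) S)
    + beta * (lweight (fun=> 1) S * (N - lweight (fun=> 1) S)
              + rweight (fun=> 1) S * (N - rweight (fun=> 1) S)) + b%:R ^+ 2.
Proof.
rewrite /gadget.
have -> : lweight (fun=> 0) S = 0 by exact: big1.
have -> : rweight (fun=> 0) S = 0 by exact: big1.
by rewrite clamp_mix_id ?normr0 ?ler0n // mul0r subr0 addr0.
Qed.

(** All clamp levels are at least [a], so here the mixture is exactly [U * V] and erases the
    dependence on [w]. *)
Lemma gadget_balanced w S : `|lweight w S| <= a%:R ->
  `|rweight w S| <= a%:R -> gadget w S = gadget (fun=> 0) S.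
Proof.
move=> hU hV; rewrite gadget0 /gadget clamp_mix_id //.
by congr (_ + _ + _); rewrite subrK.
Qed.

End Gadget.

(** * An exponential tail bound by counting *)

(** From [expR z >= 1 + z] at [z = 2 y^2 - y], because [(1 + y) (1 - y + 2 y^2) = 1 + y^2 (1 + 2 y)]
    is at least 1. *)
Lemma expR_le_1Dx (R : realType) (y : R) : - 2^-1 <= y ->
  expR (y - 2 * y ^+ 2) <= 1 + y.
Proof.
move=> hy; rewrite -opprB expRN.
have h1 := expR_ge1Dx (2 * y ^+ 2 - y).
have h2 : 0 < 1 + (2 * y ^+ 2 - y) by nra.
apply: le_trans (_ : (1 + (2 * y ^+ 2 - y))^-1 <= _).
  by rewrite lef_pV2 // posrE // (lt_le_trans h2).
rewrite -[leLHS]mul1r ler_pdivrMr //.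
have : 0 <= y ^+ 2 * (1 + 2 * y) by rewrite mulr_ge0 ?sqr_ge0 //; lra.
by rewrite expr2; lra.
Qed.

(* Markov's inequality for [\prod_i (1 + lam * xi i (s i))], whose mean under
   a uniform [s] is exactly 1. *)
Lemma card_tail_le (R : realType) (I K : finType) (xi : I -> K -> R) (c lam d : R) :
  (forall i, \sum_j xi i j = 0) -> (forall i j, `|xi i j| <= c) ->
  0 <= lam -> lam * c <= 2^-1 ->
  #|[set s : {ffun I -> K} | d <= \sum_i xi i (s i)]|%:R <=
    #|{ffun I -> K}|%:R * expR (2 * (lam * c) ^+ 2 * #|I|%:R - lam * d).
Proof.
move=> xi0 xic lam0 lamc.
set T := [set s | _].
(* Each factor is thus positive, and on the tail event the product is at least
   [expR (lam d - 2 (lam c)^2 #|I|)]. *)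
have step i j : expR (lam * xi i j - 2 * (lam * c) ^+ 2) <= 1 + lam * xi i j.
  have h : `|lam * xi i j| <= lam * c.
    by rewrite normrM ger0_norm // ler_wpM2l.
  apply: le_trans (expR_le_1Dx _); last by move: h; rewrite ler_norml; lra.
  rewrite ler_expR lerD2l lerN2 ler_wpM2l // -[leLHS]real_normK ?num_real //.
  by rewrite ler_pXn2r ?nnegrE // (le_trans _ h).
have tot : \sum_(s : {ffun I -> K}) \prod_i (1 + lam * xi i (s i)) =
    #|{ffun I -> K}|%:R.
  rewrite -(bigA_distr_bigA (fun i j => 1 + lam * xi i j)) card_ffun natrX.
  rewrite -prodr_const; apply: eq_bigr => i _.
  by rewrite big_split /= -mulr_sumr xi0 mulr0 addr0 sumr_const.
rewrite -tot -[_ - lam * d]opprB expRN ler_pdivlMr ?expR_gt0 //.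
apply: le_trans (_ : \sum_(s in T) \prod_i (1 + lam * xi i (s i)) <= _).
  rewrite [#|T|%:R * _]mulr_natl -[X in X <= _](sumr_const (mem T)); apply: ler_sum => s.
  rewrite inE => ds.
  apply: le_trans (_ : expR (\sum_i (lam * xi i (s i) - 2 * (lam * c) ^+ 2)) <= _).
    have sumc (x : R) : \sum_(i : I) x = x * #|I|%:R.
      by rewrite sumr_const mulr_natr.
    rewrite ler_expR sumrB -mulr_sumr sumc lerD2r.
    by rewrite ler_wpM2l.
  by rewrite expR_sum; apply: ler_prod => i _; rewrite expR_ge0 step.
rewrite [leRHS](bigID (mem T)) /= lerDl; apply: sumr_ge0 => s _.
by apply: prodr_ge0 => i _; apply: le_trans (step _ _); rewrite expR_ge0.
Qed.

(** * Random hidden weights and their concentration *)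

Section HiddenWeight.
Variables (R : realType) (n m k : nat) (e : 'I_n -> bool * 'I_m * 'I_k).
Hypothesis e_bij : bijective e.
Hypothesis k_gt1 : (1 < k)%N.
Implicit Types (S : {set 'I_n}) (s : {ffun bool * 'I_m -> 'I_k}).

Definition side v := (e v).1.1.

Definition hidden s v : R := if (e v).2 == s (e v).1 then k.-1%:R else -1.

Lemma reindex_ground (F : bool * 'I_m * 'I_k -> R) :
  \sum_v F (e v) = \sum_x F x.
Proof. by rewrite [RHS](reindex e) //; apply: onW_bij. Qed.

Let pk : k.-1%:R = k%:R - 1 :> R.
Proof. by rewrite -subn1 natrB // ltnW. Qed.

Let k2 : 2 <= k%:R :> R. Proof. by rewrite ler_nat. Qed.

Lemma hidden_bounds s v : -1 <= hidden s v <= k.-1%:R.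
Proof. by have h := k2; rewrite /hidden pk; case: ifP => _; apply/andP; split; lra. Qed.

(** Read in two ways: the weight of a fixed element averages to zero over the hidden position, and
    the weights within a block sum to zero. *)
Lemma sum_hidden (j : 'I_k) :
  \sum_(l < k) (if j == l then k.-1%:R else -1 : R) = 0.
Proof.
rewrite (bigD1 j) //= eqxx (eq_bigr (fun=> -1)); last first.
  by move=> l; rewrite eq_sym => /negbTE ->.
by rewrite sumr_const cardC1 card_ord mulNrn subrr.
Qed.

(** Grouped by block, the sum has one independent mean-zero term for each of the [2 m] blocks. A
    block has [k] elements of weight at most [k] in size, so each term is at most [k^2]. The
    coefficient [c] serves to select a side and a sign. *)
Lemma card_hidden_tail (c : bool -> R) S (lam d : R) : (forall b, `|c b| <= 1) ->
  0 <= lam -> lam * k%:R ^+ 2 <= 2^-1 ->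
  #|[set s | d <= \sum_(v in S) c (side v) * hidden s v]|%:R <=
    #|{ffun bool * 'I_m -> 'I_k}|%:R *
    expR (4 * (lam * k%:R ^+ 2) ^+ 2 * m%:R - lam * d).
Proof.
move=> c1 lam0 lamk.
pose xi (i : bool * 'I_m) (j : 'I_k) : R :=
  \sum_(v in S | (e v).1 == i) c i.1 * (if (e v).2 == j then k.-1%:R else -1).
have := @card_tail_le R _ _ xi (k%:R ^+ 2) lam d.
rewrite card_prod card_bool card_ord natrM mulrA [2 * _ * 2]mulrAC -natrM.
have -> : [set s : {ffun bool * 'I_m -> 'I_k} | d <= \sum_i xi i (s i)] =
    [set s : {ffun bool * 'I_m -> 'I_k} |
      d <= \sum_(v in S) c (side v) * hidden s v].
  apply/setP => s; rewrite !inE; congr (_ <= _).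
  rewrite [RHS](partition_big (fun v => (e v).1) predT) //=.
  apply: eq_bigr => i _; apply: eq_bigr => v /andP[_ /eqP <-] //.
apply=> // [i|i j].
  rewrite exchange_big big1 // => v _.
  by rewrite -mulr_sumr sum_hidden mulr0.
apply: le_trans (ler_norm_sum _ _ _) _.
apply: le_trans (_ : \sum_(v | (e v).1 == i) k%:R <= _).
  rewrite big_mkcondl /=; apply: ler_sum => v _; case: ifP => // _.
  rewrite normrM -[leRHS]mul1r ler_pM //.
  by have h := k2; rewrite ler_norml pk; case: ifP => _; apply/andP; split; lra.
rewrite big_mkcond /= (reindex_ground (fun x => if x.1 == i then k%:R else 0)).
rewrite -(pair_big predT predT (fun x _ => if x == i then k%:R else 0)) /=.
rewrite (bigD1 i) //= eqxx [X in _ + X]big1 => [|x /negbTE ->]; last first.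
  by rewrite big1.
by rewrite addr0 sumr_const card_ord -[_ *+ _]mulr_natr expr2.
Qed.

(** Union bound over two sides and two signs, which [c1] to [c4] select. *)
Lemma card_unbalanced_le S (lam : R) (d : nat) : 0 <= lam ->
  lam * k%:R ^+ 2 <= 2^-1 ->
  #|[set s | ~~ ((`|lweight side (hidden s) S| <= d%:R) &&
                 (`|rweight side (hidden s) S| <= d%:R))]|%:R <=
    #|{ffun bool * 'I_m -> 'I_k}|%:R *
    (4 * expR (4 * (lam * k%:R ^+ 2) ^+ 2 * m%:R - lam * d%:R)).
Proof.
move=> lam0 lamk.
pose T c := [set s | d%:R <= \sum_(v in S) c (side v) * hidden s v].
pose c1 := fun b : bool => b%:R : R.
pose c2 := fun b : bool => - (b%:R) : R.
pose c3 := fun b : bool => (~~ b)%:R : R.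
pose c4 := fun b : bool => - (~~ b)%:R : R.
have T1 := @card_hidden_tail c1 S lam d%:R.
have T2 := @card_hidden_tail c2 S lam d%:R.
have T3 := @card_hidden_tail c3 S lam d%:R.
have T4 := @card_hidden_tail c4 S lam d%:R.
have b1 b : `|c1 b| <= 1 by rewrite /c1; case: b; rewrite ?normr1 ?normr0.
have b2 b : `|c2 b| <= 1 by rewrite /c2 normrN b1.
have b3 b : `|c3 b| <= 1 by rewrite /c3 b1.
have b4 b : `|c4 b| <= 1 by rewrite /c4 normrN b3.
move: (T1 b1 lam0 lamk) (T2 b2 lam0 lamk) (T3 b3 lam0 lamk) (T4 b4 lam0 lamk).
set E := expR _; set O := #|_|%:R => {}T1 {}T2 {}T3 {}T4.
have sub : [set s | ~~ ((`|lweight side (hidden s) S| <= d%:R) &&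
    (`|rweight side (hidden s) S| <= d%:R))] \subset
    (T c1 :|: T c2) :|: (T c3 :|: T c4).
  apply/subsetP => s; rewrite !inE.
  have -> : \sum_(v in S) c1 (side v) * hidden s v = lweight side (hidden s) S.
    rewrite /lweight [RHS]big_mkcondr; apply: eq_bigr => v _.
    by rewrite /c1; case: (side v); rewrite ?mul1r ?mul0r.
  have -> : \sum_(v in S) c2 (side v) * hidden s v = - lweight side (hidden s) S.
    rewrite -sumrN [RHS]big_mkcondr; apply: eq_bigr => v _.
    by rewrite /c2; case: (side v); rewrite ?mulN1r ?oppr0 ?mul0r.
  have -> : \sum_(v in S) c3 (side v) * hidden s v = rweight side (hidden s) S.
    rewrite /rweight [RHS]big_mkcondr; apply: eq_bigr => v _.
    by rewrite /c3; case: (side v); rewrite ?mul1r ?mul0r.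
  have -> : \sum_(v in S) c4 (side v) * hidden s v = - rweight side (hidden s) S.
    rewrite -sumrN [RHS]big_mkcondr; apply: eq_bigr => v _.
    by rewrite /c4; case: (side v); rewrite ?mulN1r ?oppr0 ?mul0r.
  by rewrite negb_and -!ltNge !lter_normr => /orP[] /orP[] /ltW ->; rewrite ?orbT.
apply: le_trans (_ : (#|T c1| + #|T c2| + (#|T c3| + #|T c4|))%:R <= _).
  rewrite ler_nat; apply: leq_trans (subset_leq_card sub) _.
  have cardU (A B : {set {ffun bool * 'I_m -> 'I_k}}) : (#|A :|: B| <= #|A| + #|B|)%N.
    by rewrite cardsU leq_subr.
  by apply: leq_trans (cardU _ _) _; apply: leq_add; apply: cardU.
by rewrite !natrD; lra.
Qed.

End HiddenWeight.

(** * Query algorithms against indistinguishable functions *)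

Section Indistinguishability.
Variables (R : realType) (n : nat) (Out : Type).
Implicit Types (A : strategy R n Out) (f g : {set 'I_n} -> R) (h : seq R).

Fixpoint queries A f (q : nat) h : seq {set 'I_n} :=
  match A h with
  | Done _ => [::]
  | Query X => if q is q'.+1 then X :: queries A f q' (rcons h (f X)) else [::]
  end.

Lemma size_queries A f q h : (size (queries A f q h) <= q)%N.
Proof.
by elim: q h => [|q IH] h /=; case: (A h) => //= X; apply: IH.
Qed.

(** The queries are those asked under [g], hence fixed before any hidden index is drawn; agreement
    on them keeps the history, and so the whole run, the same. *)
Lemma run_eq_on_queries A f g q h :
  all (fun X => f X == g X) (queries A g q h) -> run A f q h = run A g q h.
Proof.
elim: q h => [|q IH] h /=; case: (A h) => //= X /andP[/eqP -> ]; exact: IH.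
Qed.

Variables (valid : Out -> Prop) (mu : Out -> {set 'I_n} -> R).
Hypothesis mu_ge0 : forall o S, valid o -> 0 <= mu o S.
Hypothesis mu_sum : forall o, valid o -> \sum_S mu o S = 1.

(** Common form of both objectives: a point mass [mu o] gives the value of a set, a product measure
    gives the multilinear extension. *)
Definition avg f (o : Out) : R := \sum_S f S * mu o S.

Lemma avg_le f (c : R) o : valid o -> (forall S, f S <= c) -> avg f o <= c.
Proof.
move=> vo fc; apply: le_trans (_ : \sum_S c * mu o S <= _).
  by apply: ler_sum => S _; rewrite ler_wpM2r // mu_ge0.
by rewrite -mulr_sumr mu_sum // mulr1.
Qed.

Variables (I : finType) (fs : I -> {set 'I_n} -> R) (g : {set 'I_n} -> R).
Variables (M B : R) (q : nat).
Hypothesis fs_ge0 : forall i S, 0 <= fs i S.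
Hypothesis fs_le : forall i S, fs i S <= M.
Hypothesis g_ge0 : forall S, 0 <= g S.
Hypothesis card_differ : forall S, #|[set i | fs i S != g S]|%:R <= B.
Hypothesis M_ge0 : 0 <= M.

(** The output stays fixed while [i] varies: each [S] is charged [M] for the at most [B] indices at
    which [fs i S] differs from [g S]. *)
Lemma sum_avg_le o : valid o ->
  \sum_i avg (fs i) o <= #|I|%:R * avg g o + M * B.
Proof.
move=> vo; rewrite /avg exchange_big /=.
have -> : #|I|%:R * avg g o + M * B = \sum_S (#|I|%:R * g S + M * B) * mu o S.
  rewrite (eq_bigr (fun S => #|I|%:R * (g S * mu o S) + M * B * mu o S)).
    by rewrite big_split /= -!mulr_sumr mu_sum // mulr1.
  by move=> S _; ring.
apply: ler_sum => S _; rewrite -mulr_suml ler_wpM2r ?mu_ge0 //.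
apply: le_trans (_ : \sum_i (g S + M * (fs i S != g S)%:R) <= _).
  apply: ler_sum => i _; case: eqP => [->|_]; first by rewrite mulr0 addr0.
  by rewrite mulr1 -[leLHS]add0r lerD.
rewrite big_split /= sumr_const -[_ *+ _]mulr_natl lerD2l -mulr_sumr ler_wpM2l //.
apply: le_trans (card_differ S).
by rewrite -natr_sum -big_mkcond sum1dep_card lexx.
Qed.

(** At most [q * B] indices are betrayed by a set asked under [g]; for all others the strategy
    outputs the same [o]. Evaluating that output costs as much as one more query, whence [q.+1]. *)
Lemma sum_out_value_le A o : run A g q [::] = Some o -> valid o ->
  (forall i, exists2 o', run A (fs i) q [::] = Some o' & valid o') ->
  \sum_i out_value (avg (fs i)) A (fs i) q <=
    #|I|%:R * avg g o + M * (q.+1%:R * B).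
Proof.
move=> Ao vo vs.
pose bad := [set i | has (fun X => fs i X != g X) (queries A g q [::])].
have cbad : #|bad|%:R <= q%:R * B.
  have B0 : 0 <= B by apply: le_trans (card_differ set0).
  apply: le_trans (_ : (size (queries A g q [::]))%:R * B <= _); last first.
    by rewrite ler_wpM2r // ler_nat size_queries.
  rewrite /bad; elim: (queries _ _ _ _) => [|X s IH] /=.
    have -> : [set i | false] = set0 :> {set I} by apply/setP => i; rewrite !inE.
    by rewrite cards0 mul0r.
  apply: le_trans (_ : #|[set i | fs i X != g X]|%:R +
    #|[set i | has (fun X => fs i X != g X) s]|%:R <= _); last first.
    by rewrite -nat1r mulrDl mul1r lerD.
  rewrite -natrD ler_nat.
  have -> : [set i | (fs i X != g X) || has (fun X => fs i X != g X) s] =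
    [set i | fs i X != g X] :|: [set i | has (fun X => fs i X != g X) s].
    by apply/setP => i; rewrite !inE.
  by rewrite cardsU leq_subr.
apply: le_trans (_ : \sum_i (avg (fs i) o + M * (i \in bad)%:R) <= _).
  apply: ler_sum => i _; rewrite /out_value inE.
  have avg0 : 0 <= avg (fs i) o.
    by apply: sumr_ge0 => S _; rewrite mulr_ge0 // mu_ge0.
  case: (boolP (has _ _)) => [_|].
    have [o' -> vo'] := vs i.
    by rewrite mulr1 -[leLHS]add0r lerD // avg_le.
  rewrite -all_predC => good.
  rewrite (@run_eq_on_queries A (fs i) g) ?Ao ?mulr0 ?addr0 //.
  by apply: sub_all good => X /=; rewrite negbK.
rewrite big_split /= -mulr_sumr -natr_sum.
have -> : (\sum_i (i \in bad) = #|bad|)%N by rewrite -big_mkcond sum1_card.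
have := sum_avg_le vo.
have : M * #|bad|%:R <= M * (q%:R * B) by rewrite ler_wpM2l.
by rewrite -natr1; lra.
Qed.

Lemma all_prop_forall (T J : Type) (P : T -> Prop) (Q : J -> T -> Prop) (s : seq T) :
  all_prop P s -> (forall j, all_prop (Q j) s) ->
  all_prop (fun x => P x /\ forall j, Q j x) s.
Proof.
elim: s => //= x s IH [Px Ps] H; split; first by split=> // j; case: (H j).
by apply: IH => // j; case: (H j).
Qed.

Lemma sum_all_prop_le (T : Type) (P : R * T -> Prop) (F : R * T -> R) (C : R)
    (s : seq (R * T)) :
  all_prop P s -> (forall c, c \in map fst s -> 0 <= c) ->
  (forall x, P x -> F x <= C) ->
  \sum_(x <- s) x.1 * F x <= \sum_(c <- map fst s) c * C.
Proof.
move=> + + FC; elim: s => [|x s IH] /=; first by rewrite !big_nil.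
move=> [Px Ps] c0; rewrite !big_cons lerD //.
  by rewrite ler_wpM2l ?FC // c0 // inE eqxx.
by apply: IH => // c cs; rewrite c0 // inE cs orbT.
Qed.

(** Averaging argument for randomized algorithms: sum the guarantees over all hidden indices,
    exchange this sum with the one over strategies, and bound each deterministic strategy
    separately. *)
Lemma indistinguishable_value_le (d : seq (R * strategy R n Out))
    (alpha opt G : R) :
  0 <= alpha ->
  achieves valid (avg g) d g q alpha ->
  (forall i, achieves valid (avg (fs i)) d (fs i) q alpha) ->
  (forall i, exists2 y, valid y & opt <= avg (fs i) y) ->
  (forall o, valid o -> avg g o <= G) ->
  #|I|%:R * (alpha * opt) <= #|I|%:R * G + M * (q.+1%:R * B).
Proof.
move=> alpha0 [[d0 d1] dg _] achs opts gG.
apply: le_trans (_ : \sum_i \sum_(x <- d) x.1 * out_value (avg (fs i)) x.2 (fs i) q <= _).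
  rewrite mulr_natl -sumr_const; apply: ler_sum => i _.
  have [y vy hy] := opts i; have [_ _ /(_ y vy)] := achs i.
  by apply: le_trans; rewrite ler_wpM2l.
rewrite exchange_big /=; under eq_bigr do rewrite -mulr_sumr.
have vs i : all_prop (fun ps : R * strategy R n Out =>
    exists2 o, run ps.2 (fs i) q [::] = Some o & valid o) d by case: (achs i).
have {vs} ds := all_prop_forall dg vs.
apply: le_trans (sum_all_prop_le ds d0 (_ : forall x, _ -> _ <= _)) _; last first.
  by rewrite -mulr_suml d1 mul1r.
move=> [c A] /= [[o Ao vo] vs].
apply: le_trans (sum_out_value_le Ao vo vs) _.
by rewrite lerD2r ler_wpM2l // gG.
Qed.

End Indistinguishability.

(** * Partition matroids *)

(** If [A] is smaller than [B], it is smaller within some block, and an element of [B] outside [A]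
    from that block can be added. *)
Lemma partition_is_matroid (n : nat) (I : {set {set 'I_n}}) :
  is_partition_matroid I -> is_matroid I.
Proof.
move=> [K [g [k ->]]]; split.
- by rewrite inE; apply/forallP => i; rewrite set0I cards0.
- move=> A B; rewrite !inE => /forallP hB sAB; apply/forallP => i.
  by apply: leq_trans (hB i); rewrite subset_leq_card // setSI.
move=> A B; rewrite !inE => /forallP hA /forallP hB cAB.
have cE (X : {set 'I_n}) : #|X| = (\sum_i #|X :&: [set v | g v == i]|)%N.
  rewrite -sum1_card (partition_big g predT) //=; apply: eq_bigr => i _.
  by rewrite -sum1_card; apply: eq_bigl => v; rewrite !inE.
have [i ci] : exists i, (#|A :&: [set v | g v == i]| < #|B :&: [set v | g v == i]|)%N.
  apply/existsP; apply: contraTT cAB; rewrite negb_exists => /forallP h.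
  by rewrite -leqNgt !cE; apply: leq_sum => i _; rewrite leqNgt.
have [x xB xA] : exists2 x, x \in B :&: [set v | g v == i] &
    x \notin A :&: [set v | g v == i].
  apply/subsetPn; apply: contraTN ci => /subset_leq_card.
  by rewrite -leqNgt.
move: xB xA; rewrite !inE => /andP[xB /eqP gx]; rewrite gx eqxx andbT => xA.
exists x; first by rewrite inE xA xB.
rewrite inE; apply/forallP => j; have [ji|ji] := eqVneq j i.
  apply: leq_trans (hB j); rewrite ji; apply: leq_trans ci.
  have -> : (x |: A) :&: [set v | g v == i] = x |: (A :&: [set v | g v == i]).
    by apply/setP => v; rewrite !inE; case: eqVneq => // ->; rewrite gx eqxx.
  by rewrite cardsU1 !inE (negbTE xA) add1n.
have -> : (x |: A) :&: [set v | g v == j] = A :&: [set v | g v == j].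
  apply/setP => v; rewrite !inE; case: eqVneq => //= ->.
  by rewrite gx eq_sym (negbTE ji) andbF.
exact: hA.
Qed.

(** * Product measures and the feasible polytope *)

Section Multilinear.
Variables (R : realType) (n : nat).
Implicit Types (x : 'I_n -> R) (S : {set 'I_n}).

Definition product_measure x S : R :=
  (\prod_(i in S) x i) * \prod_(i in ~: S) (1 - x i).

Lemma multilinear_avg f x : multilinear f x = avg product_measure f x.
Proof. by apply: eq_bigr => S _; rewrite -mulrA. Qed.

Lemma product_measureE x S :
  product_measure x S = \prod_i (if i \in S then x i else 1 - x i).
Proof.
rewrite (bigID (mem S)) /=; congr (_ * _).
  by apply: eq_bigr => i /= ->.
rewrite (eq_bigl (fun i => i \notin S)); last by move=> i; rewrite inE.
by apply: eq_bigr => i /negbTE ->.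
Qed.

Lemma product_measure_ge0 x S : (forall i, 0 <= x i <= 1) ->
  0 <= product_measure x S.
Proof.
move=> hx; rewrite product_measureE; apply: prodr_ge0 => i _.
by have := hx i; case: ifP => _; lra.
Qed.

Lemma product_measure_sum x : \sum_S product_measure x S = 1.
Proof.
under eq_bigr do rewrite product_measureE.
rewrite -(bigA_distr _ _ x (fun i => 1 - x i)) big1 // => i _.
by rewrite /= addrC subrK.
Qed.

Lemma product_measure_cut x i j : i != j ->
  \sum_(S : {set 'I_n}) ((i \in S) && (j \notin S))%:R * product_measure x S = x i * (1 - x j).
Proof.
move=> ij.
(* The factors of the forbidden choices, [i] left out and [j] taken, are set to zero, so that the
   sum over [S] still factors over the elements. *)
pose F l := if l == j then 0 else x l.
pose G l := if l == i then 0 else 1 - x l.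
transitivity (\sum_(S : {set 'I_n}) \prod_l (if l \in S then F l else G l)).
  apply: eq_bigr => S _; rewrite product_measureE.
  have [h|] := boolP (_ && _).
    rewrite mul1r; apply: eq_bigr => l _; move: h => /andP[iS jS].
    rewrite /F /G; case: ifP => lS.
      by case: eqP => // E; move: jS; rewrite -E lS.
    by case: eqP => // E; move: lS; rewrite E iS.
  rewrite mul0r negb_and negbK => /orP[iS|jS].
    by rewrite (bigD1 i) //= (negbTE iS) /G eqxx mul0r.
  by rewrite (bigD1 j) //= jS /F eqxx mul0r.
rewrite -(bigA_distr _ _ F G) (bigD1 i) //= (bigD1 j) 1?eq_sym //=.
rewrite /F /G !eqxx (negbTE ij) [j == i]eq_sym (negbTE ij) addr0 add0r mulrA.
rewrite big1 ?mulr1 // => l /andP[li lj].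
by rewrite (negbTE li) (negbTE lj) /= addrC subrK.
Qed.

Lemma product_measure_indicator S T :
  product_measure (fun i => (i \in S)%:R) T = (T == S)%:R.
Proof.
rewrite product_measureE; case: eqP => [->|/eqP].
  by rewrite big1 // => i _; case: (i \in S); rewrite ?subr0.
rewrite eqEsubset negb_and => /orP[] /subsetPn[i iT iS].
  by rewrite (bigD1 i) //= iT (negbTE iS) mul0r.
by rewrite (bigD1 i) //= (negbTE iS) iT subrr mul0r.
Qed.

Lemma avg_point_measure (f : {set 'I_n} -> R) S :
  avg (fun o T => (T == o)%:R) f S = f S.
Proof.
rewrite /avg (bigD1 S) //= eqxx mulr1 big1 ?addr0 // => T /negbTE ->.
by rewrite mulr0.
Qed.

Lemma polytope_bounds (F : {set {set 'I_n}}) x : in_polytope F x ->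
  forall i, 0 <= x i <= 1.
Proof.
move=> [lam [lam0 _ lam1 xE]] i; rewrite xE sumr_ge0 /= => [|S _].
  rewrite -[leRHS]lam1; apply: ler_sum => S _.
  by rewrite -[leRHS]mulr1 ler_wpM2l // lern1 leq_b1.
by rewrite mulr_ge0.
Qed.

Lemma polytope_vertex (F : {set {set 'I_n}}) S : S \in F ->
  in_polytope F (fun i => (i \in S)%:R : R).
Proof.
move=> SF; exists (fun T => (T == S)%:R); split.
- by [].
- by move=> T; case: eqP => // ->; rewrite SF.
- by rewrite (bigD1 S) //= eqxx big1 ?addr0 // => T /negbTE ->.
move=> i; rewrite (bigD1 S) //= eqxx mul1r big1 ?addr0 // => T /negbTE ->.
by rewrite mul0r.
Qed.

(** A linear functional constant on the generating sets keeps its value on their convex hull; this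
    fixes the mass of a fractional point on each side. *)
Lemma polytope_count (F : {set {set 'I_n}}) (P : pred 'I_n) (c : nat) x :
  (forall S, S \in F -> #|[set v in S | P v]| = c) -> in_polytope F x ->
  \sum_(i | P i) x i = c%:R.
Proof.
move=> cF [lam [lam0 lamF lam1 xE]].
under eq_bigr do rewrite xE; rewrite exchange_big /=.
rewrite -[RHS]mul1r -[X in _ = X * _]lam1 mulr_suml; apply: eq_bigr => S _.
have [SF|/lamF ->] := boolP (S \in F); last first.
  by rewrite mul0r big1 // => i _; rewrite mul0r.
rewrite -mulr_sumr -(cF _ SF) -sum1_card natr_sum big_mkcond [in RHS]big_mkcond.
congr (_ * _); apply: eq_bigr => i _; rewrite inE.
by case: (P i); case: (i \in S).
Qed.

End Multilinear.

(** * The constraints of the hard instances *)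

Section Instance.
Variables (R : realType) (n m k : nat) (e : 'I_n -> bool * 'I_m * 'I_k).
Hypothesis e_bij : bijective e.
Hypothesis k_gt1 : (1 < k)%N.
Implicit Types (S : {set 'I_n}) (s : {ffun bool * 'I_m -> 'I_k}).
Notation side := (side e).
Notation hidden := (hidden R e).
Notation p := k.-1.

Definition part (v : 'I_n) : 'I_2 := if side v then ord0 else ord_max.
Definition part_size (c : 'I_2) : nat := if c == ord0 then m else (p * m)%N.

Definition two_colors : constraint n :=
  @Constraint n 2 part part_size part_size setT.

Definition one_color : constraint n :=
  @Constraint n 1 (fun=> ord0) (fun=> (k * m)%N) (fun=> (k * m)%N)
    [set X : {set 'I_n} |
      [forall c : 'I_2, (#|X :&: [set v | part v == c]| <= part_size c)%N]].

Definition class_constraint (cl : inst_class) : constraint n :=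
  if cl is OneColorPartition then one_color else two_colors.

Definition balanced_sets : {set {set 'I_n}} :=
  [set S : {set 'I_n} | (#|[set v in S | side v]| == m) &&
     (#|[set v in S | ~~ side v]| == p * m)%N].

Lemma forall_I2 (P : pred 'I_2) : [forall c, P c] = P ord0 && P ord_max.
Proof.
apply/forallP/andP => [h|[h0 h1] c]; first by split.
by case: c => -[|[|//]] h; [move: h0 | move: h1]; congr (is_true (P _));
   apply: val_inj.
Qed.

Lemma part0 S : S :&: [set v | part v == ord0] = [set v in S | side v].
Proof. by apply/setP => v; rewrite !inE /part; case: (side v). Qed.

Lemma part1 S : S :&: [set v | part v == ord_max] = [set v in S | ~~ side v].
Proof. by apply/setP => v; rewrite !inE /part; case: (side v). Qed.

Lemma card_sides S : #|S| = (#|[set v in S | side v]| + #|[set v in S | ~~ side v]|)%N.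
Proof.
rewrite -!sum1_card (bigID side) /=.
by congr (_ + _)%N; apply: eq_bigl => v; rewrite !inE.
Qed.

(** With one color, the matroid caps [m] and [p * m] add up to the required total [k * m], so both
    are attained. *)
Lemma feasible_class cl : feasible (class_constraint cl) = balanced_sets.
Proof.
have two : feasible two_colors = balanced_sets.
  apply/setP => S; rewrite !inE /fair forall_I2 /=.
  by rewrite part0 part1 /part_size /= -!eqn_leq !(eq_sym _ #|_|).
have kE : (k * m = m + p * m)%N by rewrite -mulSn prednK // ltnW.
case: cl; [exact: two | exact: two |]. apply/setP => S; rewrite !inE /fair /= forall_I2.
rewrite part0 part1 /part_size /=.
have -> : [forall c : 'I_1, (k * m <= #|S :&: [set v | ord0 == c]| <= k * m)%N]
    = (#|S| == k * m)%N.
  apply/forallP/idP => [/(_ ord0)|/eqP <- c].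
    rewrite -eqn_leq eq_sym.
    suff -> : S :&: [set v | (ord0 : 'I_1) == ord0] = S by [].
        by apply/setP => v; rewrite !inE andbT.
  have -> : S :&: [set v | (ord0 : 'I_1) == c] = S; last by rewrite leqnn.
  by apply/setP => v; rewrite !inE (ord1 c) eqxx andbT.
rewrite card_sides kE.
by move: #|_| #|_| (p * m)%N => x y z; lia.
Qed.

Lemma class_constraint_in_class cl : in_class cl (class_constraint cl).
Proof. by case: cl => //=; split => //; exists 2, part, part_size. Qed.

(** The boolean equation keeps the hidden elements on the left and the others on the right; this is
    the set with the large cut value. *)
Definition hidden_set s : {set 'I_n} :=
  [set v | side v == ((e v).2 == s (e v).1)].

Lemma sum_by_block (F : bool -> R) s :
  \sum_(v in hidden_set s) F (side v) = m%:R * F true + (p * m)%:R * F false.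
Proof.
pose H (x : bool * 'I_m * 'I_k) : R :=
  if x.1.1 == (x.2 == s x.1) then F x.1.1 else 0.
rewrite big_mkcond /= (eq_bigr (fun v => H (e v))); last first.
  by move=> v _; rewrite inE.
rewrite reindex_ground //.
have -> : \sum_x H x = \sum_b \sum_i \sum_j H (b, i, j).
  by rewrite !pair_bigA; apply: eq_bigr => -[[]].
rewrite big_bool /=.
have ct i : \sum_j H (true, i, j) = F true.
  rewrite (bigD1 (s (true, i))) //= /H /= eqxx big1 ?addr0 // => j /negbTE -> //.
have cf i : \sum_j H (false, i, j) = p%:R * F false.
  rewrite (bigD1 (s (false, i))) //= {1}/H /= eqxx add0r.
  rewrite (eq_bigr (fun=> F false)); last by move=> j /negbTE h; rewrite /H /= h.
  by rewrite sumr_const cardC1 card_ord mulr_natl.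
rewrite (eq_bigr _ (fun i _ => ct i)) (eq_bigr _ (fun i _ => cf i)).
by rewrite !sumr_const card_ord natrM -mulr_natl -[_ *+ m]mulr_natl /=; ring.
Qed.

Lemma card_left S : #|[set v in S | side v]|%:R = lweight side (fun=> 1 : R) S.
Proof.
by rewrite -sum1_card natr_sum; apply: eq_bigl => v; rewrite inE.
Qed.

Lemma card_right S : #|[set v in S | ~~ side v]|%:R = rweight side (fun=> 1 : R) S.
Proof.
by rewrite -sum1_card natr_sum; apply: eq_bigl => v; rewrite inE.
Qed.

Lemma hidden_setE s v : v \in hidden_set s ->
  hidden s v = if side v then p%:R else -1.
Proof. by rewrite inE /hidden => /eqP ->. Qed.

Lemma lweight_hidden_set s : (lweight side (fun=> 1 : R) (hidden_set s) = m%:R) *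
  (lweight side (hidden s) (hidden_set s) = p%:R * m%:R).
Proof.
rewrite /lweight !big_mkcondr; split.
  by rewrite (sum_by_block (fun b => if b then 1 else 0)) /=; ring.
under eq_bigr => v vS do rewrite hidden_setE //.
by rewrite (sum_by_block (fun b => if b then if b then p%:R else -1 else 0)) /=; ring.
Qed.

Lemma rweight_hidden_set s :
  (rweight side (fun=> 1 : R) (hidden_set s) = p%:R * m%:R) *
  (rweight side (hidden s) (hidden_set s) = - (p%:R * m%:R)).
Proof.
rewrite /rweight !big_mkcondr; split.
  by rewrite (sum_by_block (fun b => if ~~ b then 1 else 0)) /= natrM /=; ring.
under eq_bigr => v vS do rewrite hidden_setE //.
rewrite (sum_by_block (fun b => if ~~ b then if b then p%:R else -1 else 0)) /=.
by rewrite natrM /=; ring.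
Qed.

Lemma hidden_set_balanced s : hidden_set s \in balanced_sets.
Proof.
rewrite inE -!(eqr_nat R) card_left card_right natrM.
by rewrite lweight_hidden_set rweight_hidden_set !eqxx.
Qed.

Lemma balanced_setsP S : S \in balanced_sets ->
  (lweight side (fun=> 1 : R) S = m%:R) *
  (rweight side (fun=> 1 : R) S = p%:R * m%:R).
Proof.
by rewrite inE -card_left -card_right => /andP[/eqP -> /eqP ->]; rewrite natrM.
Qed.

Lemma total_weight (F : bool -> R) (G : 'I_k -> R) :
  \sum_v F (side v) * G (e v).2 = m%:R * (F true + F false) * \sum_j G j.
Proof.
rewrite (reindex_ground e_bij (fun x => F x.1.1 * G x.2)).
have -> : \sum_(x : bool * 'I_m * 'I_k) F x.1.1 * G x.2 =
    \sum_b \sum_(i < m) \sum_j F b * G j.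
  by rewrite !pair_bigA.
have sumc (x : R) : \sum_(i < m) x = m%:R * x.
  by rewrite sumr_const card_ord mulr_natl.
by rewrite big_bool /= !sumc -!mulr_sumr; ring.
Qed.

Lemma lweight_total : lweight side (fun=> 1 : R) setT = (k * m)%:R.
Proof.
rewrite /lweight big_mkcondr /=.
have := total_weight (fun b => b%:R) (fun=> 1).
rewrite sumr_const card_ord natrM addr0 mulr1 mulrC => <-.
by apply: eq_big => v; rewrite ?inE // mulr1; case: (side v).
Qed.

Lemma rweight_total : rweight side (fun=> 1 : R) setT = (k * m)%:R.
Proof.
rewrite /rweight big_mkcondr /=.
have := total_weight (fun b => (~~ b)%:R) (fun=> 1).
rewrite sumr_const card_ord natrM add0r mulr1 mulrC => <-.
by apply: eq_big => v; rewrite ?inE // mulr1; case: (side v).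
Qed.

Lemma rweight_hidden_total s : rweight side (hidden s) setT = 0.
Proof.
rewrite /rweight big_mkcondr /=.
pose H (x : bool * 'I_m * 'I_k) : R :=
  if x.1.1 then 0 else if x.2 == s x.1 then p%:R else -1.
rewrite (eq_big predT (fun v => H (e v))); first last.
- by move=> v _; rewrite /hidden /H -if_neg negbK.
- by move=> v; rewrite inE.
rewrite reindex_ground //.
have -> : \sum_x H x = \sum_x \sum_j H (x, j).
  by rewrite pair_bigA; apply: eq_bigr => -[].
rewrite big1 // => -[b i] _; rewrite /H; case: b => /=; first by rewrite big1.
rewrite -[RHS](sum_hidden R (s (false, i))).
by apply: eq_bigr => j _; rewrite eq_sym.
Qed.

Lemma class_well_formed cl : (0 < m)%N -> well_formed (class_constraint cl).
Proof.
move=> m0; split.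
- have [->|[_ h]] : indep (class_constraint cl) = setT \/
      in_class OneColorPartition (class_constraint cl).
    by case: cl; [left|left|right; apply: (class_constraint_in_class OneColorPartition)].
    split=> [|A B _ _|A B _ _ AB]; rewrite ?inE //.
    have /subsetPn[x xB xA] : ~~ (B \subset A).
      by apply: contraTN AB => /subset_leq_card; rewrite -leqNgt.
    by exists x; rewrite !inE ?xB ?xA.
  exact: partition_is_matroid.
- by case: cl => /= c.
exists (hidden_set [ffun=> Ordinal (ltnW k_gt1)]).
by rewrite feasible_class hidden_set_balanced.
Qed.

(* The uniform mixture of the [k] sets hiding the same position in every block
   has coordinates [1/k] on the left side and [1 - 1/k] on the right side. *)
Lemma class_min_linf cl :
  min_linf_le (feasible (class_constraint cl)) (1 - (k%:R : R)^-1).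
Proof.
have k2 : 2 <= k%:R :> R by rewrite ler_nat.
have kV : 0 < (k%:R : R)^-1 <= 2^-1.
  by rewrite invr_gt0 lef_pV2 ?posrE //; lra.
pose sh (j : 'I_k) := hidden_set [ffun=> j].
exists (fun v => \sum_(j < k) k%:R^-1 * (v \in sh j)%:R); split.
  left; rewrite feasible_class.
  exists (fun S => \sum_(j < k) k%:R^-1 * (S == sh j)%:R); split.
  - by move=> S; apply: sumr_ge0 => j _; rewrite mulr_ge0 //; lra.
  - move=> S SF; apply: big1 => j _; case: eqP => [E|_]; last by rewrite mulr0.
    by move: SF; rewrite E hidden_set_balanced.
  - rewrite exchange_big /= (eq_bigr (fun=> k%:R^-1)) => [|j _].
      by rewrite sumr_const card_ord -[_ *+ _]mulr_natr mulVf //; lra.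
    by rewrite -mulr_sumr (bigD1 (sh j)) //= eqxx big1 ?addr0 ?mulr1 // => S /negbTE ->.
  move=> v; under [RHS]eq_bigr do rewrite mulr_suml.
  rewrite exchange_big /=; apply: eq_bigr => j _.
  rewrite (bigD1 (sh j)) //= eqxx mulr1 big1 ?addr0 // => S /negbTE ->.
  by rewrite mulr0 mul0r.
move=> v; rewrite -mulr_sumr ger0_norm ?mulr_ge0 ?sumr_ge0 //; last by lra.
(* A left element lies in exactly one of the [k] sets, a right element in all but one. *)
have -> : \sum_(j < k) (v \in sh j)%:R = if side v then 1 else k%:R - 1 :> R.
  under eq_bigr do rewrite inE ffunE.
  case: (side v); rewrite (bigD1 (e v).2) //= eqxx.
    by rewrite big1 ?addr0 // => j /negbTE; rewrite eq_sym => ->.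
  rewrite add0r (eq_bigr (fun=> 1)); last first.
    by move=> j /negbTE; rewrite eq_sym => ->.
  by rewrite sumr_const cardC1 card_ord -subn1 natrB // ltnW.
case: (side v); first by rewrite mulr1; lra.
by rewrite mulrBr mulr1 mulVf //; lra.
Qed.

End Instance.

(** * The value inequality for fixed parameters *)

Lemma achieves_ext (R : realType) (n : nat) (Out : Type) (valid : Out -> Prop)
    (v1 v2 : Out -> R) (d : seq (R * strategy R n Out)) f q alpha :
  v1 =1 v2 -> achieves valid v1 d f q alpha -> achieves valid v2 d f q alpha.
Proof.
move=> v12 [hd hv ha]; split=> // y vy; rewrite -v12.
apply: le_trans (ha y vy) _; rewrite le_eqVlt; apply/orP; left; apply/eqP.
apply: eq_bigr => ps _; rewrite /out_value.
by case: (run _ _ _ _) => [o|]; rewrite ?v12.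
Qed.

Section LowerBound.
Variables (R : realType) (k J L D : nat) (beta : R).
Let b := (2 ^ J * D)%N.
Let m := (L * b)%N.
Let p := k.-1.
Variables (n : nat) (e : 'I_n -> bool * 'I_m * 'I_k).
Hypothesis e_bij : bijective e.
Hypothesis k_gt1 : (1 < k)%N.
Hypotheses (J_gt0 : (0 < J)%N) (L_gt0 : (0 < L)%N) (D_gt0 : (0 < D)%N).
Hypothesis beta_gt0 : 0 < beta.
Hypothesis J_large : 2 * (p * (2 * (2 * p)).+1)%:R <= beta * J%:R.

Let H : R := \sum_(D <= l < b) (l%:R)^-1.
Let om (l : nat) : R := (l%:R)^-1 / H.
Let N : R := (k * m)%:R.
Let gad := gadget (side e) D b p om N beta.

Let H_ge : J%:R / 2 <= H. Proof. exact: harmonic_block_ge. Qed.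

Let H_gt0 : 0 < H.
Proof. by apply: lt_le_trans H_ge; rewrite divr_gt0 ?ltr0n. Qed.

Let om_ge0 l : 0 <= om l.
Proof. by rewrite mulr_ge0 ?invr_ge0 // ltW. Qed.

Let om_sum : \sum_(D <= l < b) om l = 1.
Proof. by rewrite -mulr_suml divff // gt_eqF. Qed.

(** For [l > 0] the product [om l * l] is [1 / H], hence at most [2 / J], and [J_large] turns this
    into the bound by [beta]. *)
Let om_le l : om l * l%:R * (p * (2 * (2 * p)).+1)%:R <= beta.
Proof.
case: l => [|l]; first by rewrite mulr0 mul0r ltW.
rewrite /om [_ / H * _]mulrAC mulVf ?pnatr_eq0 // mul1r mulrC ler_pdivrMr //.
apply: le_trans (ler_wpM2l (ltW beta_gt0) H_ge).
by move: J_large; lra.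
Qed.

Let p_gt0 : (0 < p)%N. Proof. by rewrite /p; case: (k) k_gt1 => [|[]]. Qed.

Let b_gt0 : (0 < b)%N. Proof. by rewrite muln_gt0 expn_gt0. Qed.

Let m_gt0 : (0 < m)%N. Proof. by rewrite muln_gt0 L_gt0. Qed.

Let kp : k%:R = p%:R + 1 :> R. Proof. by rewrite natr1 prednK // ltnW. Qed.

Let lcard : lweight (side e) (fun=> 1 : R) setT = N.
Proof. exact: lweight_total. Qed.

Let rcard : rweight (side e) (fun=> 1 : R) setT = N.
Proof. exact: rweight_total. Qed.

(** Covers both the hidden weights and [w = 0], under one and the same constraint, so that the
    constraint reveals nothing. *)
Lemma gadget_admissible cl w : (forall v, -1 <= w v <= p%:R) ->
  rweight (side e) w setT = 0 ->
  admissible cl (1 - (k%:R)^-1) (class_constraint e cl) (gad w).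
Proof.
move=> hw w0; split.
- exact: class_constraint_in_class.
- exact: (class_well_formed R).
- by move=> S; apply: (proj2 (gadget_ge om_ge0 om_sum lcard rcard S hw w0 (ltW beta_gt0))).
- by apply: gadget_submodular => //; exact: ltW.
exact: class_min_linf.
Qed.

Let M : R := (p%:R + p%:R ^+ 2 + 2 * beta) * N ^+ 2 + 2 * b%:R ^+ 2.

(** On the left is [alpha] times what the hidden set is worth. On the right is what the symmetric
    instance allows, [p m^2] and the smoothing terms, followed by the cost of being detected. *)
Lemma query_value_bound cl (Out : Type) (valid : Out -> Prop)
    (mu : Out -> {set 'I_n} -> R) (d : seq (R * strategy R n Out)) (q : nat)
    (alpha lam : R) :
  (forall o S, valid o -> 0 <= mu o S) ->
  (forall o, valid o -> \sum_S mu o S = 1) ->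
  (forall s, exists2 y, valid y & forall f, avg mu f y = f (hidden_set e s)) ->
  (forall o, valid o -> avg mu (fun S => lweight (side e) (fun=> 1) S *
     (N - rweight (side e) (fun=> 1) S)) o <= m%:R ^+ 2) ->
  (forall f, admissible cl (1 - (k%:R)^-1) (class_constraint e cl) f ->
     achieves valid (avg mu f) d f q alpha) ->
  0 <= alpha -> 0 <= lam -> lam * k%:R ^+ 2 <= 2^-1 ->
  alpha * (p%:R * k%:R * m%:R ^+ 2) <=
    p%:R * m%:R ^+ 2 + 2 * beta * N ^+ 2 + b%:R ^+ 2 +
    M * (q.+1%:R * (4 * expR (4 * (lam * k%:R ^+ 2) ^+ 2 * m%:R - lam * D%:R))).
Proof.
move=> mu0 mu1 vert cut ach alpha0 lam0 lamk.
set E := expR _.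
pose O : R := #|{ffun bool * 'I_m -> 'I_k}|%:R.
have O0 : 0 < O :> R.
  by rewrite ltr0n; apply/card_gt0P; exists [ffun=> Ordinal (ltnW k_gt1)].
have hb s v : -1 <= hidden R e s v <= p%:R by exact: hidden_bounds.
have zb : -1 <= (0 : R) <= p%:R by rewrite lerN10 ler0n.
have zt : rweight (side e) (fun=> 0 : R) setT = 0 by exact: big1.
have ht s : rweight (side e) (hidden R e s) setT = 0 by exact: rweight_hidden_total.
have beta0 := ltW beta_gt0.
have ge w S (hw : forall v, -1 <= w v <= p%:R) (w0 : rweight (side e) w setT = 0) :=
  gadget_ge om_ge0 om_sum lcard rcard S hw w0 beta0.
have B0 S : #|[set s : {ffun bool * 'I_m -> 'I_k} | gad (hidden R e s) S != gad (fun=> 0) S]|%:R <=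
    O * (4 * E).
  apply: le_trans (card_unbalanced_le e_bij k_gt1 S D lam0 lamk).
  rewrite ler_nat subset_leq_card //; apply/subsetP => s; rewrite !inE.
  by apply: contra => /andP[hU hV]; apply/eqP; apply: gadget_balanced.
have opt s : exists2 y, valid y &
    p%:R * k%:R * m%:R ^+ 2 <= avg mu (gad (hidden R e s)) y.
  have [y vy yE] := vert s; exists y => //; rewrite yE.
  apply: le_trans (proj1 (ge _ _ (hb s) (ht s))).
  (* Here [X = m], [Z = p m], [U = p m] and [V = - p m], so [p X (N - Z) - U V = p m^2 + p^2 m^2 = p
     k m^2]. *)
  rewrite !(lweight_hidden_set R e_bij) !(rweight_hidden_set R e_bij).
  by rewrite /N natrM kp -/p; lra.
have bound o : valid o -> avg mu (gad (fun=> 0)) o <=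
    p%:R * m%:R ^+ 2 + 2 * beta * N ^+ 2 + b%:R ^+ 2.
  move=> vo; rewrite -addrA.
  set c := 2 * beta * N ^+ 2 + b%:R ^+ 2.
  apply: le_trans (lerD (ler_wpM2l (ler0n _ p) (cut o vo)) (lexx c)).
  have cE : c = \sum_S c * mu o S by rewrite -mulr_sumr mu1 // mulr1.
  rewrite /avg cE mulr_sumr -big_split /=.
  apply: ler_sum => S _; rewrite mulrA -mulrDl ler_wpM2r ?mu0 //.
  rewrite /gad gadget0 //.
  have /andP[X0 XN] := @lweight_le R n (side e) (fun=> 1) S (fun=> ler01).
  have /andP[Z0 ZN] := @rweight_le R n (side e) (fun=> 1) S (fun=> ler01).
  rewrite lcard in XN; rewrite rcard in ZN.
  move: X0 XN Z0 ZN; set X := lweight _ _ _; set Z := rweight _ _ _ => X0 XN Z0 ZN.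
  have : beta * (X * (N - X) + Z * (N - Z)) <= beta * (2 * N ^+ 2).
    by rewrite ler_wpM2l //; nra.
  by rewrite /c; lra.
have M0 : 0 <= M.
  by apply: le_trans (gadget_le p_gt0 om_ge0 om_sum lcard rcard set0 (fun=> zb) beta0);
     apply: (proj2 (ge _ _ (fun=> zb) zt)).
have := @indistinguishable_value_le R n Out valid mu mu0 mu1
  {ffun bool * 'I_m -> 'I_k} (fun s => gad (hidden R e s)) (gad (fun=> 0))
  M (O * (4 * E)) q
  (fun s S => proj2 (ge _ S (hb s) (ht s)))
  (fun s S => gadget_le p_gt0 om_ge0 om_sum lcard rcard S (hb s) beta0)
  (fun S => proj2 (ge _ S (fun=> zb) zt)) B0 M0 d alpha _ _ alpha0
  (ach _ (gadget_admissible cl (fun=> zb) zt))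
  (fun s => ach _ (gadget_admissible cl (hb s) (ht s))) opt bound.
rewrite -/O => h; rewrite -(ler_pM2l O0); apply: le_trans h _.
by rewrite le_eqVlt; apply/orP; left; apply/eqP; ring.
Qed.

End LowerBound.

(** * Numerical estimates and the choice of parameters *)

(** With [y = D / W], the factor [q.+1] is at most [2 ^ (D %/ W) <= expR y], which leaves
    [expR (- y) <= 1 / y]. *)
Lemma query_count_expR_le (R : realType) (D W q : nat) : (0 < D)%N -> (0 < W)%N ->
  (q < 2 ^ (D %/ W))%N ->
  q.+1%:R * expR (- (2 * (D%:R / W%:R))) <= W%:R / D%:R :> R.
Proof.
move=> D0 W0 hq; set y : R := D%:R / W%:R.
have y0 : 0 < y by rewrite divr_gt0 ?ltr0n.
have hq' : q.+1%:R <= expR y :> R.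
  apply: le_trans (_ : (2 ^ (D %/ W))%:R <= _); first by rewrite ler_nat.
  apply: le_trans (_ : expR ((D %/ W)%:R : R) <= _); last first.
    by rewrite ler_expR /y ler_pdivlMr ?ltr0n // -natrM ler_nat leq_trunc_div.
  rewrite natrX -[(D %/ W)%:R]mulr1 expRM_natl lerXn2r ?nnegrE ?expR_ge0 //.
  by have := expR_ge1Dx (1 : R); lra.
apply: le_trans (ler_wpM2r (expR_ge0 _) hq') _.
rewrite -expRD [y + _](_ : _ = - y); last by ring.
rewrite expRN -[W%:R / D%:R]invf_div -/y lef_pV2 ?posrE ?expR_gt0 //.
by have := expR_ge1Dx y; lra.
Qed.

(** The left side exceeds [p m^2] by [eps p k m^2]. On the right, the [beta] term takes a quarter of
    this excess, while [b^2] and the detection term take at most [eps m^2 / 4] each; as [p k >= 2],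
    that is too little. *)
Lemma gap_contradiction (R : realType) (k p eps beta m b T : R) :
  2 <= k -> p = k - 1 -> 0 < eps -> beta = eps * p / (8 * k) -> 0 < m ->
  0 <= b -> b <= m -> 4 * b <= eps * m ->
  ((p + p ^+ 2 + 2 * beta) * k ^+ 2 + 2) * T <= eps / 4 -> 0 <= T ->
  (k^-1 + eps) * (p * k * m ^+ 2) <=
    p * m ^+ 2 + 2 * beta * (k * m) ^+ 2 + b ^+ 2 +
    ((p + p ^+ 2 + 2 * beta) * (k * m) ^+ 2 + 2 * b ^+ 2) * T -> False.
Proof.
move=> k2 pk eps0 betaE m0 b0 bm b4 hT T0.
have lhs : (k^-1 + eps) * (p * k * m ^+ 2) = p * m ^+ 2 + eps * p * k * m ^+ 2.
  by field; lra.
have bE : 2 * beta * (k * m) ^+ 2 = eps * p * k * m ^+ 2 / 4.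
  by rewrite betaE; field; lra.
have bb : b ^+ 2 <= m * (eps * m / 4) by rewrite expr2; apply: ler_pM => //; lra.
have b2m : b ^+ 2 * T <= m ^+ 2 * T.
  by rewrite ler_wpM2r // ler_pXn2r ?nnegrE // ltW.
have mm : 0 < m ^+ 2 by rewrite exprn_gt0.
have hTm : m ^+ 2 * (((p + p ^+ 2 + 2 * beta) * k ^+ 2 + 2) * T) <= m ^+ 2 * (eps / 4).
  by rewrite ler_wpM2l // ltW.
have em : 0 < eps * m ^+ 2 by rewrite mulr_gt0.
have pk2 : 2 * (eps * m ^+ 2) <= p * k * (eps * m ^+ 2).
  by rewrite ler_wpM2r ?(ltW em) // pk; nra.
by rewrite lhs bE; lra.
Qed.

(** The product counts pairs of a left element taken and a right element left out. These events are
    independent under the product measure, so the mean is [m * (k m - p m)]: fractional points do no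
    better than sets. *)
Lemma balanced_cut (R : realType) (n m k : nat) (e : 'I_n -> bool * 'I_m * 'I_k)
    (x : 'I_n -> R) : bijective e -> (1 < k)%N ->
  in_polytope (balanced_sets e) x ->
  avg (@product_measure R n) (fun S => lweight (side e) (fun=> 1) S *
     ((k * m)%:R - rweight (side e) (fun=> 1) S)) x = m%:R ^+ 2.
Proof.
move=> e_bij k1 xP.
have cutE S : lweight (side e) (fun=> 1 : R) S *
    ((k * m)%:R - rweight (side e) (fun=> 1) S) =
    \sum_(i | side e i) \sum_(j | ~~ side e j) ((i \in S) && (j \notin S))%:R.
  rewrite -(rweight_total R e_bij) /lweight /rweight.
  rewrite 3!big_mkcondl /=.
  rewrite -sumrB mulr_suml; apply: eq_bigr => i _; rewrite mulr_sumr.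
  apply: eq_bigr => j _; rewrite inE.
  by case: (i \in S); case: (j \in S); rewrite ?subrr ?subr0 ?mulr0 ?mulr1 ?mul0r.
rewrite /avg; under eq_bigr do rewrite cutE mulr_suml.
rewrite exchange_big /=.
transitivity ((\sum_(i | side e i) x i) * \sum_(j | ~~ side e j) (1 - x j)).
  rewrite mulr_suml; apply: eq_bigr => i si.
  under eq_bigr do rewrite mulr_suml.
  rewrite exchange_big /= mulr_sumr; apply: eq_bigr => j sj.
  by rewrite product_measure_cut //; apply: contraNneq sj => <-.
rewrite sumrB.
have -> : \sum_(j | ~~ side e j) 1 = (k * m)%:R :> R.
  rewrite -(rweight_total R e_bij) /rweight; apply: eq_bigl => j.
  by rewrite inE.
rewrite (@polytope_count _ _ (balanced_sets e) _ m) //; last first.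
  by move=> S; rewrite inE => /andP[/eqP ->].
rewrite (@polytope_count _ _ (balanced_sets e) _ (k.-1 * m)) //; last first.
  by move=> S; rewrite inE => /andP[_ /eqP ->].
have -> : (k * m = m + k.-1 * m)%N by rewrite -mulSn prednK // ltnW.
by rewrite natrD addrK expr2.
Qed.

Theorem theorem3p7 (R : realType) (t : nat) (eps : R) :
  (2 <= t)%N -> 0 < eps ->
  let r : R := 1 - (t%:R)^-1 in
  forall cl : inst_class,
    exists c : nat, (0 < c)%N /\
      forall N0 : nat, exists n : nat, (N0 <= n)%N /\
        (forall (q : nat) (A : algorithm R n {set 'I_n}),
            solves_discrete cl r A q (1 - r + eps) -> (2 ^ (n %/ c) <= q)%N) /\
        (forall (q : nat) (A : algorithm R n ('I_n -> R)),
            solves_relaxation cl r A q (1 - r + eps) -> (2 ^ (n %/ c) <= q)%N).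
Proof.
rename t into k => k1 eps0 r cl.
set p := k.-1.
have p0 : (0 < p)%N by rewrite /p; case: (k) k1 => [|[]].
have kR : 2 <= k%:R :> R by rewrite ler_nat.
have pR : p%:R = k%:R - 1 :> R by rewrite /p -subn1 natrB // ltnW.
pose beta : R := eps * p%:R / (8 * k%:R).
have beta0 : 0 < beta by rewrite divr_gt0 ?mulr_gt0 ?ltr0n // ltnW.
have nat_above (x : R) : exists2 l : nat, (0 < l)%N & x <= l%:R.
  exists (Num.truncn x).+1 => //; apply/ltW.
  by have := real_truncnS_gt (num_real x).
(* [J] doublings of the clamp level spread the mixture until [beta] absorbs its curvature. *)
have [J J0 HJ] := nat_above (2 * (p * (2 * (2 * p)).+1)%:R / beta).
(* Gives [4 * b <= eps * m], so the constant [b ^ 2] is small against [m ^ 2]. *)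
have [L L0 HL] := nat_above (4 / eps).
have [Q QE] : exists Q, Q = (2 ^ J * L)%N by eexists.
have Q0 : (0 < Q)%N by rewrite QE muln_gt0 expn_gt0.
(* With the [lam] chosen below, the tail exponent becomes [- 2 D / W]: half of it pays for the
   queries, the other half leaves a small factor. *)
have [W WE] : exists W, W = (32 * k ^ 4 * Q)%N by eexists.
have W0 : (0 < W)%N by rewrite WE muln_gt0 Q0 andbT muln_gt0 expn_gt0 (ltnW k1).
exists (2 * k * Q * W)%N; split.
  by rewrite !muln_gt0 Q0 W0 (ltnW k1).
move=> N0.
pose M0 : R := (p%:R + p%:R ^+ 2 + 2 * beta) * k%:R ^+ 2 + 2.
(* For [D >= D1] the detection factor [4 M0 W / D] is at most [eps / 4]; [D >= N0] will make [n]
   large. *)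
have [D1 D10 HD] := nat_above (16 * M0 * W%:R / eps).
pose D := maxn N0 D1.
have D0 : (0 < D)%N by rewrite leq_max D10 orbT.
pose b := (2 ^ J * D)%N; pose m := (L * b)%N.
have mE : m = (Q * D)%N by rewrite /m /b QE; lia.
pose n := #|{: bool * 'I_m * 'I_k}|; exists n.
have nE : n = (2 * k * Q * D)%N.
  by rewrite /n !card_prod card_bool !card_ord mE; lia.
pose e : 'I_n -> bool * 'I_m * 'I_k := enum_val.
have e_bij : bijective e by exact: enum_val_bij.
have nc : (n %/ (2 * k * Q * W) = D %/ W)%N.
  by rewrite nE divnMl // !muln_gt0 Q0 (ltnW k1).
split.
  rewrite nE; apply: leq_trans (leq_maxl N0 D1) _; rewrite -/D.
  by rewrite leq_pmull // !muln_gt0 Q0 (ltnW k1).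
have J_large : 2 * (p * (2 * (2 * p)).+1)%:R <= beta * J%:R.
  by rewrite -ler_pdivrMl // [leLHS]mulrC.
rewrite nc; set alpha := 1 - r + eps.
have alphaE : alpha = k%:R^-1 + eps by rewrite /alpha /r subKr.
have main (Out : Type) (valid : Out -> Prop) (mu : Out -> {set 'I_n} -> R)
    (d : seq (R * strategy R n Out)) (q : nat) :
  (forall o S, valid o -> 0 <= mu o S) ->
  (forall o, valid o -> \sum_S mu o S = 1) ->
  (forall s, exists2 y, valid y & forall f, avg mu f y = f (hidden_set e s)) ->
  (forall o, valid o -> avg mu (fun S => lweight (side e) (fun=> 1) S *
     ((k * m)%:R - rweight (side e) (fun=> 1) S)) o <= m%:R ^+ 2) ->
  (forall f, admissible cl r (class_constraint e cl) f ->
     achieves valid (avg mu f) d f q alpha) -> (2 ^ (D %/ W) <= q)%N.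
  move=> mu0 mu1 vert cut ach; rewrite leqNgt; apply/negP => qD.
  have Qp : 0 < Q%:R :> R by rewrite ltr0n.
  have kp : 0 < k%:R :> R by lra.
  (* The minimizer of the tail exponent [4 lam^2 k^4 m - lam D], as [m = Q D]. *)
  pose lam : R := (8 * k%:R ^+ 4 * Q%:R)^-1.
  have lamP : 0 < 8 * k%:R ^+ 4 * Q%:R :> R by rewrite !mulr_gt0 ?exprn_gt0.
  have lamk : lam * k%:R ^+ 2 = (8 * k%:R ^+ 2 * Q%:R)^-1.
    by rewrite /lam; field; rewrite !gt_eqF.
  have lamk2 : lam * k%:R ^+ 2 <= 2^-1.
    rewrite lamk lef_pV2 ?posrE ?mulr_gt0 ?exprn_gt0 //.
    have : 1 <= k%:R ^+ 2 * Q%:R :> R.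
      by rewrite -natrX -natrM ler1n muln_gt0 Q0 expn_gt0 ltnW.
    by lra.
  have alpha0 : 0 <= alpha by rewrite alphaE addr_ge0 ?invr_ge0 ?ltW.
  have lam0 : 0 <= lam by rewrite invr_ge0 ltW.
  have := @query_value_bound R k J L D beta n e e_bij k1 J0 L0 D0 beta0 J_large
    cl Out valid mu d q alpha lam mu0 mu1 vert cut ach alpha0 lam0 lamk2.
  have -> : 4 * (lam * k%:R ^+ 2) ^+ 2 * (L * (2 ^ J * D))%:R - lam * D%:R =
      - (2 * (D%:R / W%:R)).
    have -> : (L * (2 ^ J * D))%:R = Q%:R * D%:R :> R by rewrite -natrM -mE.
    by rewrite lamk /lam WE 2!natrM natrX; field; rewrite !gt_eqF.
  have hE := query_count_expR_le R D0 W0 qD.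
  set E := expR _ in hE *.
  rewrite alphaE -/b -/m -/p [(k * m)%:R]natrM => h.
  apply: (@gap_contradiction R k%:R p%:R eps beta m%:R b%:R (q.+1%:R * (4 * E))) h => //.
  - by rewrite ltr0n mE muln_gt0 Q0.
  - by rewrite ler_nat leq_pmull.
  - by rewrite /m natrM mulrA ler_wpM2r // -ler_pdivrMl // [leLHS]mulrC.
  - have M00 : 0 <= M0.
      apply: addr_ge0 => //; apply: mulr_ge0; last by rewrite exprn_ge0.
      by have := exprn_ge0 2 (ler0n R p); have := ler0n R p; lra.
    rewrite -/M0.
    apply: le_trans (_ : M0 * (4 * (W%:R / D%:R)) <= _).
      by rewrite ler_wpM2l //; lra.
    have Dp : 0 < D%:R :> R by rewrite ltr0n.
    have : 16 * M0 * W%:R / eps <= D%:R.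
      by apply: le_trans HD _; rewrite ler_nat leq_maxr.
    rewrite ler_pdivrMr // => hD.
    rewrite !mulrA ler_pdivrMr //; lra.
  - by rewrite !mulr_ge0 ?expR_ge0.
have feas := feasible_class e k1 cl.
split=> q A sol.
  apply: (main _ (fun S => S \in balanced_sets e) (fun o T => (T == o)%:R)
    (A (class_constraint e cl))).
  - by [].
  - move=> o _; rewrite (bigD1 o) //= eqxx big1 ?addr0 // => S /negbTE ->.
    by [].
  - move=> s; exists (hidden_set e s); first exact: (hidden_set_balanced R).
    by move=> f; rewrite avg_point_measure.
  (* A feasible set has [X = m] and [N - Z = k m - p m = m]. *)
  - move=> o oF; rewrite avg_point_measure.
    rewrite !(balanced_setsP R oF) natrM -/p pR.
    by rewrite le_eqVlt; apply/orP; left; apply/eqP; ring.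
  move=> f adm; have := sol _ _ adm; rewrite feas.
  by apply: achieves_ext => S; rewrite avg_point_measure.
(* Fractional points act through their product measures, and the hidden sets occur among them as
   vertices. *)
apply: (main _ (in_polytope (balanced_sets e)) (@product_measure R n)
    (A (class_constraint e cl))).
- by move=> x S xP; apply/product_measure_ge0/(polytope_bounds xP).
- by move=> x _; exact: product_measure_sum.
- move=> s; exists (fun i => (i \in hidden_set e s)%:R).
    by apply: polytope_vertex; exact: (hidden_set_balanced R).
  move=> f; rewrite -(avg_point_measure f); apply: eq_bigr => T _.
  by rewrite product_measure_indicator.
- by move=> x xP; rewrite balanced_cut.
move=> f adm; have := sol _ _ adm; rewrite feas.
by apply: achieves_ext => x; rewrite multilinear_avg.
Qed.
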